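(* Let $n\ge3$ and $1\le\alpha<\beta\le n-1$. The set $\mathcal B_{\alpha\beta}=\{\varphi_{ij}: i,j\in[1,n]\}$ of regular functions on $GL_n$ is log canonical with respect to the bracket $\{\cdot,\cdot\}_{\alpha\beta}$; that is, for every pair $f,g\in\mathcal B_{\alpha\beta}$ there is a rational number $\omega$ such that $\{f,g\}_{\alpha\beta}=\omega fg$.
   Context: **Bracket.** $e_{ij}$ are matrix units, $\langle A,B\rangle=\mathrm{Tr}(AB)$, $a\wedge b=a\otimes b-b\otimes a$, $\hat h_i=\frac1n\mathrm{diag}(\underbrace{n-i,\dots,n-i}_{i},\underbrace{-i,\dots,-i}_{n-i})$ for $1\le i\le n-1$. Put $$r_0=\sum_{i=1}^{n-1}\hat h_i\otimes\hat h_i-\sum_{i=1}^{n-2}\hat h_{i+1}\otimes\hat h_i+\varepsilon\big(\hat h_\alpha\wedge\hat h_\beta+\hat h_{\beta-1}\wedge\hat h_\alpha+\hat h_\beta\wedge\hat h_{\alpha+1}\big),$$ $\varepsilon=0$ if $\beta=\alpha+1$, $\varepsilon=1$ if $\beta>\alpha+1$, and $r_{\alpha\beta}=r_0+\sum_{i<j}e_{ji}\otimes e_{ij}+e_{\alpha+1,\alpha}\wedge e_{\beta,\beta+1}$. Define $R_+\in\mathrm{End}(\mathfrak{gl}_n)$ by $\langle R_+(\eta),\zeta\rangle=\langle r_{\alpha\beta},\eta\otimes\zeta\rangle$ (trace form on the tensor square). For functions $f,g$ on $GL_n$ with $(\nabla f)_{ij}=\partial f/\partial x_{ji}$, $$\{f,g\}_{\alpha\beta}(X)=\langle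 R_+(\nabla f\,X),\nabla g\,X\rangle-\langle R_+(X\nabla f),X\nabla g\rangle .$$ ($\det X$ is a Casimir; the bracket restricts to $SL_n$, where statements are obtained by removing $\det X$.) **Functions.** $X=(x_{ij})$ is the $n\times n$ matrix of coordinates, $X_R^C$ the submatrix with row set $R$, column set $C$, $[a,b]=\{a,\dots,b\}$. Let $$f_{ij}=\det X_{[i,n+i-j]}^{[j,n]}\ (j\ge i),\qquad f_{ij}=\det X_{[i,n]}^{[j,n-i+j]}\ (j<i).$$ If $f=f_{ij}=\det X_{[i,k]}^{[j,\ell]}$, then $f^{\rightarrow}$ (resp. $f^{\leftarrow}$, $f^{\downarrow}$, $f^{\uparrow}$) is the determinant obtained by replacing the last column $\ell$ by column $\ell+1$ of $X$ (resp. first column $j$ by column $j-1$; last row $k$ by row $k+1$; first row $i$ by row $i-1$), within the same rows (resp. columns). For $k\in[1,\alpha]$, $m\in[1,\beta]$ set, when $\alpha\ne n/2$ and $\beta\neq n/2$, $$\theta_k=f_{n+k-\alpha,k}f_{1,\beta+1}-f_{n+k-\alpha,k}^{\rightarrow}f_{1,\beta+1}^{\leftarrow},\qquad \psi_m=f_{m,n+m-\beta}f_{\alpha+1,1}-f_{m,n+m-\beta}^{\downarrow}f_{\alpha+1,1}^{\uparrow}.$$ If $\beta=n/2$, set $\psi_m=f_{m,n+m-\beta}f_{\alpha+1,1}-f_{m,n+m-\beta}^{\downarrow}f_{\alpha+1,1}^{\uparrow}$ and $\theta_k=f_{n+k-\alpha,k}\,\psi_1-f_{n+k-\alpha,k}^{\rightarrow}\,\psi_1^{*}$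 with $\psi_1^*=\det X_{[1,\beta]}^{\{\beta\}\cup[\beta+2,n]}f_{\alpha+1,1}-\det X_{[1,\beta-1]\cup\{\beta+1\}}^{\{\beta\}\cup[\beta+2,n]}f^{\uparrow}_{\alpha+1,1}$. If $\alpha=n/2$, set $\theta_k=f_{n+k-\alpha,k}f_{1,\beta+1}-f_{n+k-\alpha,k}^{\rightarrow}f_{1,\beta+1}^{\leftarrow}$ and $\psi_m=f_{m,n+m-\beta}\,\theta_1-f^{\downarrow}_{m,n+m-\beta}\,\theta_1^*$ with $\theta_1^*=\det X_{\{\alpha\}\cup[\alpha+2,n]}^{[1,\alpha]}f_{1,\beta+1}-\det X_{\{\alpha\}\cup[\alpha+2,n]}^{[1,\alpha-1]\cup\{\alpha+1\}}f_{1,\beta+1}^{\leftarrow}$. Finally $\varphi_{n+k-\alpha,k}=\theta_k$ for $k\in[1,\alpha]$, $\varphi_{m,n+m-\beta}=\psi_m$ for $m\in[1,\beta]$, and $\varphi_{ij}=f_{ij}$ for all other $(i,j)\in[1,n]^2$. *)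

(* Defs.v *)
From mathcomp Require Import all_boot all_order all_algebra.
From mathcomp Require Export mxtens.
From mathcomp Require Export mpoly.

Set Implicit Arguments.
Unset Strict Implicit.
Unset Printing Implicit Defensive.

Import GRing.Theory.
Local Open Scope ring_scope.

(* Rows, columns and all indices i, j, k, m, alpha, beta are natural numbers
   counted from 1, whereas 'I_n counts from 0: the ordinal i : 'I_n stands for
   the index i.+1.

   Elements of gl_n (x) gl_n are Kronecker products, i.e. n^2 x n^2 matrices;
   as \tr ((A *t B) *m (C *t D)) = \tr (A *m C) * \tr (B *m D), the trace form
   of the tensor square is the trace form of n^2 x n^2 matrices. *)

Section RMatrix.
Variables (F : fieldType) (n : nat).

Definition tensor (A B : 'M[F]_n) : 'M[F]_(n * n) := A *t B.

Definition wedge (A B : 'M[F]_n) : 'M[F]_(n * n) := tensor A B - tensor B A.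

Definition e (a b : nat) : 'M[F]_n :=
  \matrix_(i, j) ((i.+1 == a) && (j.+1 == b))%:R.

Definition h (i : nat) : 'M[F]_n :=
  n%:R^-1 *: diag_mx (\row_(a < n) if (a.+1 <= i)%N then n%:R - i%:R else - i%:R).

Definition r0 (alpha beta : nat) : 'M[F]_(n * n) :=
  \sum_(1 <= i < n) tensor (h i) (h i)
  - \sum_(1 <= i < n.-1) tensor (h i.+1) (h i)
  + (if beta == alpha.+1 then 0 else
       wedge (h alpha) (h beta) + wedge (h beta.-1) (h alpha)
       + wedge (h beta) (h alpha.+1)).

Definition rmx (alpha beta : nat) : 'M[F]_(n * n) :=
  r0 alpha beta
  + \sum_(1 <= i < n.+1) \sum_(i.+1 <= j < n.+1) tensor (e j i) (e i j)
  + wedge (e alpha.+1 alpha) (e beta beta.+1).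

End RMatrix.

Section Bracket.
Variables (F : fieldType) (n : nat).

(* The polynomial functions on n x n matrices, a subring of the regular
   functions on GL_n; the coordinate x_ij is the variable of index
   mxvec_index i j. *)
Local Notation P := {mpoly F[n * n]}.

Definition X : 'M[P]_n := \matrix_(i, j) 'X_(mxvec_index i j).

Definition nabla (f : P) : 'M[P]_n := \matrix_(i, j) mderiv (mxvec_index j i) f.

Section RPlus.
Variables (alpha beta : nat).

Let r : 'M[P]_(n * n) := map_mx (@mpolyC (n * n) F) (rmx F n alpha beta).

(* R_+, extended P-linearly to matrices of polynomials; its entries are read
   off from <R_+ eta, e_ba> = <r, eta (x) e_ba>. *)
Definition Rplus (eta : 'M[P]_n) : 'M[P]_n :=
  \matrix_(a, b) \tr (r *m (eta *t delta_mx b a)).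

Lemma RplusE (eta zeta : 'M[P]_n) :
  \tr (Rplus eta *m zeta) = \tr (r *m (eta *t zeta)).
Proof.
have -> : eta *t zeta =
    \sum_(b < n) \sum_(a < n) zeta b a *: (eta *t delta_mx b a).
  rewrite [in LHS](matrix_sum_delta zeta); apply/matrixP=> i j.
  rewrite !mxE !summxE mulr_sumr; apply: eq_bigr=> b _.
  rewrite !summxE mulr_sumr; apply: eq_bigr=> a _.
  by rewrite !mxE mulrCA.
rewrite mulmx_sumr raddf_sum /= [LHS]/mxtrace.
rewrite (eq_bigr (fun a => \sum_b Rplus eta a b * zeta b a)); last first.
  by move=> a _; rewrite mxE.
rewrite exchange_big; apply: eq_bigr=> b _ /=.
rewrite mulmx_sumr raddf_sum /=; apply: eq_bigr=> a _.
by rewrite mxE -scalemxAr mxtraceZ mulrC.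
Qed.

Definition bracket (f g : P) : P :=
  \tr (Rplus (nabla f *m X) *m (nabla g *m X))
  - \tr (Rplus (X *m nabla f) *m (X *m nabla g)).

End RPlus.

(* x_ab, and 0 when a or b is outside [1, n]. *)
Definition x (a b : nat) : P :=
  \sum_(i < n | i.+1 == a) \sum_(j < n | j.+1 == b) X i j.

(* det X_R^C, for index lists R and C of equal length, taken in order. *)
Definition minor (R C : seq nat) : P :=
  \det (\matrix_(i < size R, j < size R) x (nth 0%N R i) (nth 0%N C j)).

Definition itv (a b : nat) : seq nat := index_iota a b.+1.

(* f i j is the minor on rows [i, lastrow i j] and columns [j, lastcol i j]. *)
Definition lastrow (i j : nat) : nat := (if i <= j then n + i - j else n)%N.
Definition lastcol (i j : nat) : nat := (if i <= j then n else n - i + j)%N.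

Definition f (i j : nat) : P :=
  minor (itv i (lastrow i j)) (itv j (lastcol i j)).

Definition f_right (i j : nat) : P :=
  minor (itv i (lastrow i j)) (rcons (itv j (lastcol i j).-1) (lastcol i j).+1).

Definition f_left (i j : nat) : P :=
  minor (itv i (lastrow i j)) (j.-1 :: itv j.+1 (lastcol i j)).

Definition f_down (i j : nat) : P :=
  minor (rcons (itv i (lastrow i j).-1) (lastrow i j).+1) (itv j (lastcol i j)).

Definition f_up (i j : nat) : P :=
  minor (i.-1 :: itv i.+1 (lastrow i j)) (itv j (lastcol i j)).

Section Family.
Variables (alpha beta : nat).

Definition theta_gen (k : nat) : P :=
  f (n + k - alpha)%N k * f 1 beta.+1
  - f_right (n + k - alpha)%N k * f_left 1 beta.+1.

Definition psi_gen (m : nat) : P :=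
  f m (n + m - beta)%N * f alpha.+1 1
  - f_down m (n + m - beta)%N * f_up alpha.+1 1.

Definition psi1_star : P :=
  minor (itv 1 beta) (beta :: itv beta.+2 n) * f alpha.+1 1
  - minor (rcons (itv 1 beta.-1) beta.+1) (beta :: itv beta.+2 n)
    * f_up alpha.+1 1.

Definition theta1_star : P :=
  minor (alpha :: itv alpha.+2 n) (itv 1 alpha) * f 1 beta.+1
  - minor (alpha :: itv alpha.+2 n) (rcons (itv 1 alpha.-1) alpha.+1)
    * f_left 1 beta.+1.

(* beta = n/2 is stated as 2 beta = n, and likewise for alpha. *)
Definition theta (k : nat) : P :=
  if beta.*2 == n then
    f (n + k - alpha)%N k * psi_gen 1 - f_right (n + k - alpha)%N k * psi1_star
  else theta_gen k.

Definition psi (m : nat) : P :=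
  if alpha.*2 == n then
    f m (n + m - beta)%N * theta_gen 1 - f_down m (n + m - beta)%N * theta1_star
  else psi_gen m.

Definition phi (i j : nat) : P :=
  if (1 <= j <= alpha)%N && (i == n + j - alpha)%N then theta j
  else if (1 <= i <= beta)%N && (j == n + i - beta)%N then psi i
  else f i j.

Definition calB (p : P) : Prop :=
  exists i j : nat, [/\ (1 <= i <= n)%N, (1 <= j <= n)%N & p = phi i j].

End Family.
End Bracket.

Definition log_canonical (F : fieldType) (N : nat)
    (br : {mpoly F[N]} -> {mpoly F[N]} -> {mpoly F[N]})
    (S : {mpoly F[N]} -> Prop) : Prop :=
  forall p q : {mpoly F[N]}, S p -> S q ->
    exists omega : rat, br p q = ratr omega *: (p * q).

(* Main.v *)
(* Let C_ab (resp. R_ab) be the derivation replacing column a by column b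
   (resp. row b by row a).  Up to a torus term the bracket is
     sum_(a < b) (C_ab f C_ba g - R_ab f R_ba g)
       + (D f E g - E f D g) - (U f S g - S f U g),
   where D = C_{alpha,alpha+1}, E = C_{beta+1,beta}, U = R_{alpha,alpha+1} and
   S = R_{beta+1,beta}.  On minors all these derivations replace a line or
   vanish.  The sums of exchanges that survive are evaluated by the Casimir
   identity sum_(a, b) C_ab f C_ba g = sum_(a, b) R_ab f R_ba g: on one of the
   two sides the rows or columns are nested, so that (up to one exchanged row)
   only a = b contributes.

   The function theta_k is A B - (D A) (E B), where A is a minor in the last
   rows and B = f_{1,beta+1}, or B = psi_1 if 2 beta = n.  For every minor g one
   has {B, g} = - (E B) (D g) + t B g and {E B, g} = B (E g) + t' (E B) g with
   constants t and t', and substituting this makes the terms with D g and E g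
   cancel in {theta_k, g}.  The torus weights of A B and of (D A) (E B) differ,
   but have the same bracket with g by the Belavin-Drinfeld condition on r_0.
   Transposing the matrix exchanges alpha with beta and theta with psi. *)

Require Import Defs.
From mathcomp Require Import all_boot all_order all_algebra.
From mathcomp Require Import zify ring.

Set Implicit Arguments.
Unset Strict Implicit.
Unset Printing Implicit Defensive.

Import GRing.Theory.
Local Open Scope ring_scope.

(** * Derivations of minors *)

(** The case beta = n/2 is exceptional because B = f_{1,beta+1} lies in the rows [1, n - beta], and
    S moves such a minor only if its last row n - beta is beta. Then {B, g} acquires the term (S B)
    (U g). With Q = f_{alpha+1,1}, the function psi_1 = B Q - (S B) (U Q) is the same kind of
    correction made on the row side, and in it all terms with U g and S g cancel. As alpha and beta
    differ, at most one of them is n/2. Transposition does not preserve alpha < beta. The core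
    therefore assumes only that alpha and beta are different and has to carry E A and U A: E A is
    nonzero only if the first column of A is beta + 1, and U A only if its first row is alpha + 1.
    Such remainders in the brackets of theta_k with single minors cancel once these minors are
    assembled into another theta or psi. To make transposition a formal operation, the calculus
    takes place in an abstract ring with row and column derivations; polynomials enter at the
    end. *)

Definition derivation (P : comNzRingType) (d : P -> P) : Prop :=
  (forall u v, d (u + v) = d u + d v)
  /\ (forall u v, d (u * v) = d u * v + u * d v).

Section Derivations.
Variables (P : comNzRingType).
Implicit Types (d : P -> P).

Lemma derivation0 d : derivation d -> d 0 = 0.
Proof. by case=> dD _; apply: (addrI (d 0)); rewrite -dD !addr0. Qed.

Lemma derivation1 d : derivation d -> d 1 = 0.
Proof.
case=> _ dM; apply: (addrI (d 1)); rewrite addr0 -{3}[1]mulr1 dM.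
by rewrite mulr1 mul1r.
Qed.

Lemma derivationN d u : derivation d -> d (- u) = - d u.
Proof.
move=> dd; apply: (addrI (d u)); case: (dd) => dD _.
by rewrite -dD !subrr derivation0.
Qed.

Lemma derivationD d u v : derivation d -> d (u + v) = d u + d v.
Proof. by case. Qed.

Lemma derivationM d u v : derivation d -> d (u * v) = d u * v + u * d v.
Proof. by case. Qed.

Lemma derivationB d u v : derivation d -> d (u - v) = d u - d v.
Proof. by move=> dd; rewrite derivationD // derivationN. Qed.

Lemma derivation_add d1 d2 : derivation d1 -> derivation d2 ->
  derivation (fun u => d1 u + d2 u).
Proof.
move=> [a1 m1] [a2 m2]; split=> u v /=; first by rewrite a1 a2 addrACA.
by rewrite m1 m2; ring.
Qed.

Lemma derivation_scale c d : derivation d -> derivation (fun u => c * d u).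
Proof.
move=> [a1 m1]; split=> u v /=; first by rewrite a1 mulrDr.
by rewrite m1; ring.
Qed.

Lemma derivation_opp d : derivation d -> derivation (fun u => - d u).
Proof.
move=> [a1 m1]; split=> u v /=; first by rewrite a1 opprD.
by rewrite m1; ring.
Qed.

Lemma derivation_sum (I : Type) (r : seq I) (d : I -> P -> P) :
  (forall i, derivation (d i)) -> derivation (fun u => \sum_(i <- r) d i u).
Proof.
move=> dd; split=> u v.
  by rewrite -big_split; apply: eq_bigr => i _; rewrite derivationD.
rewrite mulr_suml mulr_sumr -big_split; apply: eq_bigr => i _.
by rewrite derivationM.
Qed.

Lemma derivation_sum_apply (I : Type) (r : seq I) (F : I -> P) d :
  derivation d -> d (\sum_(i <- r) F i) = \sum_(i <- r) d (F i).
Proof.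
move=> dd; elim: r => [|i r IH]; first by rewrite !big_nil derivation0.
by rewrite !big_cons derivationD // IH.
Qed.

Lemma derivation_prod (I : finType) (F : I -> P) d : derivation d ->
  d (\prod_i F i) = \sum_k \prod_i (if i == k then d (F i) else F i).
Proof.
move=> dd.
have H (r : seq I) : uniq r -> d (\prod_(i <- r) F i)
    = \sum_(k <- r) \prod_(i <- r) (if i == k then d (F i) else F i).
  elim: r => [|i r IH] /=; first by rewrite !big_nil derivation1.
  case/andP=> ir ur; rewrite !big_cons derivationM // IH // eqxx; congr (_ + _).
    congr (_ * _); rewrite !big_seq; apply: eq_bigr => j jr.
    by case: eqP ir => // <-; rewrite jr.
  rewrite mulr_sumr !big_seq; apply: eq_bigr => j jr.
  by rewrite big_cons; case: eqP ir => // ->; rewrite jr.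
by apply: H; apply: index_enum_uniq.
Qed.

(** The sums over permutations and over the differentiated factor are exchanged, which collects all
    terms that differentiate one row into one determinant. *)
Lemma derivation_det n (M : 'M[P]_n) d : derivation d ->
  d (\det M) =
  \sum_k \det (\matrix_(i, j) if i == k then d (M i j) else M i j).
Proof.
move=> dd; rewrite /determinant derivation_sum_apply // exchange_big /=.
apply: eq_bigr => s _; rewrite -mulr_sumr -signr_odd.
(* A [derivation] is only additive and Leibniz, so the sign is reduced to a boolean power of -1 and
   passes through by [derivationN]. *)
have ds (b : bool) u : d ((-1) ^+ b * u) = (-1) ^+ b * d u.
  by case: b; rewrite ?expr1 ?expr0 ?mul1r // mulN1r derivationN // mulN1r.
rewrite ds derivation_prod //; congr (_ * _); apply: eq_bigr => k _.
by apply: eq_bigr => i _; rewrite mxE.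
Qed.

End Derivations.

(* The index a of [colD] and b of [rowD] is the line that gets replaced. *)
Record biaction (P : comNzRingType) (n : nat) := Biaction {
  crd : nat -> nat -> P;
  colD : nat -> nat -> P -> P;
  rowD : nat -> nat -> P -> P;
  colD_der : forall a b, derivation (colD a b);
  rowD_der : forall a b, derivation (rowD a b);
  colD_crd : forall a b i j, (1 <= a <= n)%N ->
    colD a b (crd i j) = if j == a then crd i b else 0;
  rowD_crd : forall a b i j, (1 <= b <= n)%N ->
    rowD a b (crd i j) = if i == b then crd a j else 0;
  euler_eq : forall f, \sum_(1 <= a < n.+1) colD a a f
                       = \sum_(1 <= a < n.+1) rowD a a f;
  casimir_eq : forall f g,
    \sum_(1 <= b < n.+1) \sum_(1 <= a < n.+1) colD a b f * colD b a g
    = \sum_(1 <= b < n.+1) \sum_(1 <= a < n.+1) rowD a b f * rowD b a g }.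

Lemma transpose_casimir P n (S : biaction P n) f g :
  \sum_(1 <= b < n.+1) \sum_(1 <= a < n.+1) rowD S b a f * rowD S a b g
  = \sum_(1 <= b < n.+1) \sum_(1 <= a < n.+1) colD S b a f * colD S a b g.
Proof. by rewrite exchange_big -casimir_eq exchange_big. Qed.

(** The indices are reversed because the replaced line is the first index of [colD] and the second
    of [rowD]. Results on theta become results on psi through this record. *)
Definition transpose P n (S : biaction P n) : biaction P n :=
  @Biaction P n (fun i j => crd S j i)
    (fun a b => rowD S b a) (fun a b => colD S b a)
    (fun a b => rowD_der S b a) (fun a b => colD_der S b a)
    (fun a b i j => @rowD_crd P n S b a j i)
    (fun a b i j => @colD_crd P n S b a j i)
    (fun f => esym (@euler_eq P n S f)) (transpose_casimir S).

Definition subst_idx (a b : nat) (J : seq nat) : seq nat :=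
  [seq if c == a then b else c | c <- J].

(** * Row and column replacement in minors *)

Section Minors.
Variables (P : comNzRingType) (n : nat).
Implicit Types (S : biaction P n).

(** The order is [size I], and a shorter [J] would be read with the default index 0; facts about
    columns therefore assume [size I = size J]. *)
Definition mn S (I J : seq nat) : P :=
  \det (\matrix_(i < size I, j < size I) crd S (nth 0%N I i) (nth 0%N J j)).

Lemma mnE S I J m : size I = m ->
  mn S I J = \det (\matrix_(i < m, j < m) crd S (nth 0%N I i) (nth 0%N J j)).
Proof. by move=> <-. Qed.

Lemma mn_transpose S I J : size I = size J -> mn (transpose S) I J = mn S J I.
Proof.
move=> sIJ; rewrite [RHS](mnE S I (esym sIJ)) /mn -det_tr; congr (\det _).
by apply/matrixP => i j; rewrite !mxE.
Qed.

Lemma size_subst a b J : size (subst_idx a b J) = size J.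
Proof. by rewrite size_map. Qed.

Lemma nth_subst a b J i : (i < size J)%N ->
  nth 0%N (subst_idx a b J) i
  = if nth 0%N J i == a then b else nth 0%N J i.
Proof. by move=> iJ; rewrite (nth_map 0%N). Qed.

Lemma subst_id a J : subst_idx a a J = J.
Proof. by rewrite /subst_idx map_id_in // => c _; case: eqP. Qed.

Lemma mem_subst a b J c : (c \in subst_idx a b J)
  = ((c == b) && (a \in J)) || ((c \in J) && (c != a)).
Proof.
elim: J => [|x J IH] //=; first by rewrite !in_nil andbF.
rewrite !inE IH; case: (eqVneq x a) => [->|xa];
  case: (c \in J) => //=; case: (a \in J) => //=; lia.
Qed.

Lemma uniq_subst a b J : uniq J -> b \notin J -> uniq (subst_idx a b J).
Proof.
move=> uJ bJ; rewrite map_inj_in_uniq // => c d cJ dJ.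
case: eqP => [->|_]; case: eqP => [->|_] // E.
- by rewrite E dJ in bJ.
- by rewrite -E cJ in bJ.
Qed.

(** In the row-by-row expansion a summand whose differentiated row is not [b] has a zero row. As [I]
    has no repetition, at most one summand is left. *)
Lemma rowD_mn S a b I J : uniq I -> (1 <= b <= n)%N ->
  rowD S a b (mn S I J) = if b \in I then mn S (subst_idx b a I) J else 0.
Proof.
move=> uI bn; rewrite /mn derivation_det; last exact: rowD_der.
have E k : \det (\matrix_(i, j) (if i == k :> 'I_(size I)
      then rowD S a b ((\matrix_(i < size I, j < size I)
           crd S (nth 0%N I i) (nth 0%N J j)) i j)
      else (\matrix_(i < size I, j < size I)
           crd S (nth 0%N I i) (nth 0%N J j)) i j)) =
    if nth 0%N I k == b then mn S (subst_idx b a I) J else 0.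
  case: eqP => [Ik|Ik].
    rewrite (mnE _ _ (size_subst b a I)); congr (\det _).
    apply/matrixP => i j; rewrite !mxE nth_subst //.
    have -> : (nth 0%N I i == b) = (i == k).
      by rewrite -Ik nth_uniq.
    by case: eqP => // ->; rewrite rowD_crd // Ik eqxx.
  rewrite (expand_det_row _ k) big1 // => j _.
  by rewrite !mxE eqxx rowD_crd //; case: eqP => //; rewrite mul0r.
under eq_bigr do rewrite E.
case: ifPn => bI.
  have Ib : (index b I < size I)%N by rewrite index_mem.
  rewrite (bigD1 (Ordinal Ib)) //= nth_index // eqxx big1 ?addr0 // => k.
  move=> kI; case: eqP => // Ik; case/eqP: kI; apply: val_inj => /=.
  by rewrite -Ik index_uniq.
by rewrite big1 // => k _; case: eqP bI => // <-; rewrite mem_nth.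
Qed.

(** After the replacement the positions of [a] and [b] carry equal rows. *)
Lemma rowD_mn0 S a b I J : uniq I -> (1 <= b <= n)%N -> a != b -> a \in I ->
  rowD S a b (mn S I J) = 0.
Proof.
move=> uI bn ab aI; rewrite rowD_mn //; case: ifP => // bI.
rewrite (mnE _ _ (size_subst b a I)).
have Ib : (index b I < size I)%N by rewrite index_mem.
have Ia : (index a I < size I)%N by rewrite index_mem.
apply: (@determinant_alternate _ _ _ (Ordinal Ia) (Ordinal Ib)).
  apply: contraNneq ab => /(congr1 val) /= E.
  by rewrite -(nth_index 0%N aI) E nth_index.
by move=> j; rewrite !mxE /= !nth_subst // !nth_index // eqxx (negbTE ab).
Qed.

Lemma colD_mn S a b I J : size I = size J -> uniq J -> (1 <= a <= n)%N ->
  colD S a b (mn S I J) = if a \in J then mn S I (subst_idx a b J) else 0.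
Proof.
move=> sIJ uJ an; rewrite -[mn S I J]mn_transpose //.
rewrite -[colD S a b]/(rowD (transpose S) b a) rowD_mn //.
by rewrite mn_transpose ?size_subst.
Qed.

Lemma colD_mn0 S a b I J : size I = size J -> uniq J -> (1 <= a <= n)%N ->
  a != b -> b \in J -> colD S a b (mn S I J) = 0.
Proof.
move=> sIJ uJ an ab bJ; rewrite -[mn S I J]mn_transpose //.
by rewrite -[colD S a b]/(rowD (transpose S) b a) rowD_mn0 // eq_sym.
Qed.

End Minors.

(** * Brackets given by a Belavin-Drinfeld form *)

Section UpperSums.
Variables (P : comNzRingType) (n : nat).
Implicit Types (G : nat -> nat -> P).

Definition upper G : P := \sum_(1 <= b < n.+1) \sum_(1 <= a < b) G a b.

Lemma upper0 G :
  (forall a b, (1 <= a)%N -> (a < b)%N -> (b <= n)%N -> G a b = 0) ->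
  upper G = 0.
Proof.
move=> G0; rewrite /upper big_nat big1 // => b bn.
by rewrite big_nat big1 // => a ab; apply: G0; lia.
Qed.

Lemma upper1 G a0 b0 : (1 <= a0)%N -> (a0 < b0)%N -> (b0 <= n)%N ->
  (forall a b, (1 <= a)%N -> (a < b)%N -> (b <= n)%N ->
     ~ (a = a0 /\ b = b0) -> G a b = 0) ->
  upper G = G a0 b0.
Proof.
move=> a1 ab bn G0; rewrite /upper (bigD1_seq b0) /=; first last.
- exact: iota_uniq.
- by rewrite mem_index_iota; lia.
rewrite (bigD1_seq a0) /=; first last.
- exact: iota_uniq.
- by rewrite mem_index_iota; lia.
rewrite !big1_seq ?addr0 // => [b | a]; rewrite mem_index_iota => hb.
  by rewrite big1_seq // => a; rewrite mem_index_iota => ha; apply: G0; lia.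
by apply: G0; lia.
Qed.

Lemma upper_mulC (H : nat -> nat -> P -> P) f g :
  upper (fun a b => H b a f * H a b g) = upper (fun a b => H a b g * H b a f).
Proof. by apply: eq_bigr => b _; apply: eq_bigr => a _; rewrite mulrC. Qed.

End UpperSums.

Lemma square_sum_split (P : comNzRingType) n (G : nat -> nat -> P) :
  \sum_(1 <= b < n.+1) \sum_(1 <= a < n.+1) G a b
  = upper n G + upper n (fun a b => G b a) + \sum_(1 <= a < n.+1) G a a.
Proof.
rewrite /upper; elim: n => [|n IH]; first by rewrite !big_geq // !addr0.
rewrite !(big_nat_recr n.+1) //=.
under eq_bigr do rewrite big_nat_recr //=.
by rewrite big_split /= IH; ring.
Qed.

Section Bracket.
Variables (P : comNzRingType) (n : nat) (S : biaction P n).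
Variables (alpha beta : nat) (rho : nat -> nat -> P).

(* [upC] and [upR] are the column and the row contribution of the sum of the
   e_ji (x) e_ij over i < j; the four operators below carry the wedge term. *)
Definition upC f g := upper n (fun a b => colD S a b f * colD S b a g).
Definition upR f g := upper n (fun a b => rowD S a b f * rowD S b a g).

(** [rho p q] stands for the coefficient of e_pp (x) e_qq in r_0. *)
Definition tor f g := \sum_(1 <= p < n.+1) \sum_(1 <= q < n.+1)
  rho p q * (colD S p p f * colD S q q g - rowD S p p f * rowD S q q g).

Definition opD := colD S alpha alpha.+1.
Definition opE := colD S beta.+1 beta.
Definition opU := rowD S alpha alpha.+1.
Definition opS := rowD S beta.+1 beta.

Definition br f g := tor f g + (upC f g - upR f g)
  + (opD f * opE g - opE f * opD g) - (opU f * opS g - opS f * opU g).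

Lemma br_der f : derivation (br f).
Proof.
have cd a b : derivation (colD S a b) by exact: colD_der.
have rd a b : derivation (rowD S a b) by exact: rowD_der.
have upd (H : nat -> nat -> P -> P) : (forall a b, derivation (H a b)) ->
    derivation (fun g => upper n (fun a b => H a b f * H b a g)).
  move=> dH; apply: derivation_sum => b; apply: derivation_sum => a.
  by apply: derivation_scale.
have crossd c1 c2 d1 d2 : derivation d1 -> derivation d2 ->
    derivation (fun g => c1 * d1 g - c2 * d2 g).
  move=> dd1 dd2; apply: derivation_add; first by apply: derivation_scale.
  by apply: derivation_opp; apply: derivation_scale.
have torder : derivation (tor f).
  apply: derivation_sum => p; apply: derivation_sum => q.
  by apply: derivation_scale; apply: crossd.
have [dD dE] : derivation opD /\ derivation opE by split; apply: cd.
have [dU dS] : derivation opU /\ derivation opS by split; apply: rd.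
apply: derivation_add; last by apply: derivation_opp; apply: crossd.
apply: derivation_add; last exact: crossd.
apply: derivation_add; first exact: torder.
by apply: derivation_add; [|apply: derivation_opp]; apply: upd.
Qed.

(** The part of a Casimir sum below the diagonal is the part above it with [f] and [g] exchanged. *)
Lemma casimir_upper f g :
  upC f g + upC g f + \sum_(1 <= a < n.+1) colD S a a f * colD S a a g
  = upR f g + upR g f + \sum_(1 <= a < n.+1) rowD S a a f * rowD S a a g.
Proof.
have := casimir_eq S f g; rewrite !square_sum_split.
by rewrite (upper_mulC _ (colD S)) (upper_mulC _ (rowD S)).
Qed.

End Bracket.

(** Transposition trades [opD] with [opS] and [opE] with [opU]. Columns and rows enter the bracket
    with opposite signs, whence the minus; the reversed indices exchange the arguments. *)
Lemma br_transpose (P : comNzRingType) n (S : biaction P n) alpha beta rho f g :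
  br (transpose S) beta alpha (fun p q => rho q p) f g
  = - br S alpha beta rho g f.
Proof.
rewrite /br /opD /opE /opU /opS /=.
have -> : tor (transpose S) (fun p q => rho q p) f g = - tor S rho g f.
  rewrite /tor exchange_big -sumrN; apply: eq_bigr => p _.
  by rewrite -sumrN; apply: eq_bigr => q _ /=; ring.
rewrite /upC /upR /= (upper_mulC _ (colD S)) (upper_mulC _ (rowD S)); ring.
Qed.

(** * Index lists of minors *)

Definition wf (I J : seq nat) : Prop := [/\ uniq I, uniq J & size I = size J].

Lemma mem_itv i a b : (i \in itv a b) = (a <= i <= b)%N.
Proof. by rewrite mem_index_iota ltnS. Qed.

Lemma uniq_itv a b : uniq (itv a b).
Proof. exact: iota_uniq. Qed.

Lemma size_itv a b : size (itv a b) = (b.+1 - a)%N.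
Proof. exact: size_iota. Qed.

Lemma subst_substK a b J : b \notin J ->
  subst_idx b a (subst_idx a b J) = J.
Proof.
move=> bJ; rewrite /subst_idx -map_comp map_id_in // => c cJ /=.
case: (eqVneq c a) => [->|_]; first by rewrite eqxx.
by case: eqP => // E; rewrite -E cJ in bJ.
Qed.

Lemma wf_itv a b c d : (b.+1 - a = d.+1 - c)%N -> wf (itv a b) (itv c d).
Proof. by move=> E; split; rewrite ?uniq_itv // !size_itv. Qed.

Lemma wf_substr a b I J : wf I J -> b \notin J -> wf I (subst_idx a b J).
Proof. by case=> uI uJ sIJ bJ; split; rewrite ?size_subst ?uniq_subst. Qed.

Lemma wf_substl a b I J : wf I J -> b \notin I -> wf (subst_idx a b I) J.
Proof. by case=> uI uJ sIJ bJ; split; rewrite ?size_subst ?uniq_subst. Qed.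

(** Final segments of [1, n]: replacing one of their lines by a later one duplicates a line, so half
    of the exchanges kill the minor. *)
Definition up_closed n (I : seq nat) :=
  forall a b, (1 <= a)%N -> (a < b)%N -> (b <= n)%N -> a \in I -> b \in I.
Definition down_closed n (I : seq nat) :=
  forall a b, (1 <= a)%N -> (a < b)%N -> (b <= n)%N -> b \in I -> a \in I.

Lemma up_closed_itv n a : up_closed n (itv a n).
Proof. by move=> c d; rewrite !mem_itv; lia. Qed.

Lemma down_closed_itv n b : down_closed n (itv 1 b).
Proof. by move=> c d; rewrite !mem_itv; lia. Qed.

(* [K] stands for the rational constants; [bd_cond] is the Belavin-Drinfeld
   condition relating the roots alpha and beta. *)
Record bd_form (P : comNzRingType) (n alpha beta : nat) (K : P -> Prop)
    (rho : nat -> nat -> P) (kappa : P) : Prop := BdForm {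
  bd_alpha : (1 <= alpha < n)%N;
  bd_beta : (1 <= beta < n)%N;
  bd_neq : alpha != beta;
  bd_K1 : K 1;
  bd_KB : forall u v, K u -> K v -> K (u - v);
  bd_Krho : forall p q, K (rho p q);
  bd_sym : forall p q, (1 <= p <= n)%N -> (1 <= q <= n)%N ->
    rho p q + rho q p = (p == q)%:R - kappa;
  bd_cond : forall q, (1 <= q <= n)%N ->
    rho beta q - rho beta.+1 q + rho q alpha - rho q alpha.+1 = 0 }.

Lemma bd_transpose (P : comNzRingType) n alpha beta (K : P -> Prop) rho kappa :
  bd_form n alpha beta K rho kappa ->
  bd_form n beta alpha K (fun p q => rho q p) kappa.
Proof.
case=> ha hb ab K1 KB Kr hs hc; split=> //; first by rewrite eq_sym.
  by move=> p q hp hq; rewrite addrC hs.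
by move=> q hq; rewrite -(hc q hq); ring.
Qed.

Section Indicators.
Variables (P : comNzRingType) (n : nat).

(** In this additive form a line replacement changes weights and counts linearly. *)
Lemma subst_indicator a b (J : seq nat) p : a \in J -> b \notin J ->
  (p \in subst_idx a b J)%:R = (p \in J)%:R - (p == a)%:R + (p == b)%:R :> P.
Proof.
move=> aJ bJ; rewrite mem_subst aJ andbT.
case: (eqVneq p a) => [->|pa].
  by rewrite aJ; case: eqP => [ab|_] /=; [rewrite -ab aJ in bJ | ring].
by case: (eqVneq p b) => [->|pb]; rewrite ?(negbTE bJ) ?andbT /=; ring.
Qed.

Lemma sum_indicator (F : nat -> P) a : (1 <= a <= n)%N ->
  \sum_(1 <= p < n.+1) F p * (p == a)%:R = F a.
Proof.
move=> ha; rewrite (bigD1_seq a) /= ?iota_uniq ?mem_index_iota // eqxx mulr1.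
by rewrite big1 ?addr0 // => p /negbTE ->; rewrite mulr0.
Qed.

End Indicators.

(** * The minors f_ij *)

Section Corners.
Variables (P : comNzRingType) (n : nat).
Implicit Types (S : biaction P n).

Definition corner S i j := mn S (itv i (lastrow n i j)) (itv j (lastcol n i j)).

(** The positions that [phi] leaves to f_ij; the two excluded diagonals carry theta and psi. *)
Definition ordinary alpha beta i j := [&& (1 <= i <= n)%N, (1 <= j <= n)%N,
  ~~ ((1 <= j <= alpha)%N && (i == n + j - alpha)%N)
  & ~~ ((1 <= i <= beta)%N && (j == n + i - beta)%N)].

Lemma corner_top S i j : (i <= j)%N ->
  corner S i j = mn S (itv i (n + i - j)) (itv j n).
Proof. by move=> ij; rewrite /corner /lastrow /lastcol ij. Qed.

Lemma corner_bottom S i j : (j <= i)%N -> (i <= n)%N ->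
  corner S i j = mn S (itv i n) (itv j (n - i + j)).
Proof.
rewrite /corner /lastrow /lastcol => ji iN; case: leqP => // ij.
have -> : i = j by lia.
have -> : (n + j - j = n)%N by lia.
by have -> : (n - j + j = n)%N by lia.
Qed.

Lemma corner_transpose S i j : (1 <= i <= n)%N -> (1 <= j <= n)%N ->
  corner S i j = mn (transpose S) (itv j (lastrow n j i)) (itv i (lastcol n j i)).
Proof.
move=> hi hj; rewrite mn_transpose; last first.
  by rewrite !size_itv /lastrow /lastcol; case: leqP; lia.
have [ij|ji] := leqP i j.
  rewrite corner_top // /lastrow /lastcol; case: leqP => // ji.
    have -> : i = j by lia.
    by rewrite (_ : n + j - j = n)%N //; lia.
  by rewrite (_ : n + i - j = n - j + i)%N //; lia.
rewrite corner_bottom ?(ltnW ji) //; last lia.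
rewrite /lastrow /lastcol (ltnW ji) (_ : n - i + j = n + j - i)%N //; lia.
Qed.

End Corners.

(** * Brackets of minors and their torus weights *)

Section BelavinDrinfeld.
Variables (P : comNzRingType) (n alpha beta : nat) (S : biaction P n).
Variables (K : P -> Prop) (rho : nat -> nat -> P) (kappa : P).
Hypothesis bd : bd_form n alpha beta K rho kappa.

Local Notation br := (br S alpha beta rho).
Local Notation colD := (colD S).
Local Notation rowD := (rowD S).
Local Notation mn := (mn S).
Local Notation opD := (opD S alpha).
Local Notation opE := (opE S beta).
Local Notation opU := (opU S alpha).
Local Notation opS := (opS S beta).
Local Notation upC := (upC S).
Local Notation upR := (upR S).
Local Notation corner := (corner S).
Local Notation ordinary := (ordinary n alpha beta).

Let alpha_range : (1 <= alpha < n)%N := bd_alpha bd.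
Let beta_range : (1 <= beta < n)%N := bd_beta bd.
Let alpha_neq_beta : alpha != beta := bd_neq bd.

Lemma K0 : K 0.
Proof. by rewrite -(subrr 1); apply: (bd_KB bd); apply: bd_K1 bd. Qed.

Lemma KN u : K u -> K (- u).
Proof. by move=> Ku; rewrite -sub0r; apply: (bd_KB bd) => //; apply: K0. Qed.

Lemma KD u v : K u -> K v -> K (u + v).
Proof. by move=> Ku Kv; rewrite -[v]opprK; apply: (bd_KB bd) => //; apply: KN. Qed.

Lemma Knat m : K m%:R.
Proof.
elim: m => [|m IH]; first exact: K0.
by rewrite -addn1 natrD; apply: KD => //; apply: bd_K1 bd.
Qed.

Lemma Ksum (r : seq nat) (F : nat -> P) :
  (forall i, K (F i)) -> K (\sum_(i <- r) F i).
Proof.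
move=> KF; elim: r => [|i r IH]; first by rewrite big_nil; apply: K0.
by rewrite big_cons; apply: KD.
Qed.

(** The symmetric part of [rho] is the identity minus a constant. The constant contributes nothing
    by the Euler identity, and the identity supplies the diagonal terms that complete the upper sums
    to the Casimir identity. *)
Lemma br_skew f g : br g f = - br f g.
Proof.
apply/eqP; rewrite -addr_eq0; apply/eqP.
have torD : tor S rho g f + tor S rho f g
   = \sum_(1 <= a < n.+1) colD a a f * colD a a g
     - \sum_(1 <= a < n.+1) rowD a a f * rowD a a g.
  have hk : \sum_(1 <= p < n.+1) \sum_(1 <= q < n.+1)
      kappa * (colD p p f * colD q q g - rowD p p f * rowD q q g) = 0.
    transitivity (kappa *
        ((\sum_(1 <= p < n.+1) colD p p f) * (\sum_(1 <= q < n.+1) colD q q g)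
        - (\sum_(1 <= p < n.+1) rowD p p f)
          * (\sum_(1 <= q < n.+1) rowD q q g))); last first.
      by rewrite !euler_eq subrr mulr0.
    rewrite !mulr_suml -sumrB mulr_sumr; apply: eq_bigr => p _.
    by rewrite !mulr_sumr -sumrB mulr_sumr.
  rewrite {1}/tor exchange_big /tor -big_split -sumrB -[RHS]subr0 -[X in _ - X]hk.
  rewrite -sumrB; apply: eq_big_nat => p hp /=.
  rewrite -big_split /= [RHS](_ : _ = \sum_(1 <= q < n.+1)
    ((p == q)%:R - kappa)
      * (colD p p f * colD q q g - rowD p p f * rowD q q g)).
    by apply: eq_big_nat => q hq; rewrite -(bd_sym bd) //; ring.
  under [RHS]eq_bigr do rewrite mulrBl.
  rewrite sumrB; congr (_ - _).
  rewrite (bigD1_seq p) /= ?iota_uniq ?mem_index_iota // eqxx mul1r.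
  by rewrite big1 ?addr0 // => q /negbTE; rewrite eq_sym => ->; rewrite mul0r.
have := casimir_upper S f g; rewrite /br.
move: torD; set t1 := tor _ _ _ _; set t2 := tor _ _ _ _.
set c1 := upC _ _; set c2 := upC _ _; set r1 := upR _ _.
set r2 := upR _ _; set s1 := \sum_(_ <= _ < _) _.
set s2 := \sum_(_ <= _ < _) _ => torD cas.
have -> : c1 = r1 + r2 + s2 - s1 - c2 by rewrite -cas; ring.
have -> : t1 = s1 - s2 - t2 by rewrite -torD; ring.
ring.
Qed.

(** [rho] as a bilinear form on the indicator vectors of two index lists; in [wgtl] and [wgtr] one
    of them is a unit vector. *)
Definition wgt (J J' : seq nat) : P := \sum_(1 <= p < n.+1) \sum_(1 <= q < n.+1)
  rho p q * (p \in J)%:R * (q \in J')%:R.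
Definition wgtl p (J' : seq nat) : P :=
  \sum_(1 <= q < n.+1) rho p q * (q \in J')%:R.
Definition wgtr (J : seq nat) q : P :=
  \sum_(1 <= p < n.+1) rho p q * (p \in J)%:R.

Lemma K_wgt J J' : K (wgt J J').
Proof.
apply: Ksum => p; apply: Ksum => q.
case: (p \in J); case: (q \in J'); rewrite ?mulr1 ?mulr0 ?mul0r;
  solve [exact: K0 | exact: bd_Krho bd _ _].
Qed.

Lemma wgt_left J J' :
  wgt J J' = \sum_(1 <= p < n.+1) wgtl p J' * (p \in J)%:R.
Proof.
apply: eq_bigr => p _; rewrite mulr_suml; apply: eq_bigr => q _; ring.
Qed.

Lemma wgt_right J J' :
  wgt J J' = \sum_(1 <= q < n.+1) wgtr J q * (q \in J')%:R.
Proof.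
rewrite /wgt exchange_big; apply: eq_bigr => p _; rewrite mulr_suml.
by apply: eq_bigr => q _; ring.
Qed.

Lemma wgt_substl a b J J' : a \in J -> b \notin J ->
  (1 <= a <= n)%N -> (1 <= b <= n)%N ->
  wgt (subst_idx a b J) J' = wgt J J' - wgtl a J' + wgtl b J'.
Proof.
move=> aJ bJ ha hb; rewrite !wgt_left -(sum_indicator (wgtl^~ J') ha).
rewrite -(sum_indicator (wgtl^~ J') hb) -sumrB -big_split.
by apply: eq_bigr => p _ /=; rewrite subst_indicator //; ring.
Qed.

Lemma wgt_substr a b J J' : a \in J' -> b \notin J' ->
  (1 <= a <= n)%N -> (1 <= b <= n)%N ->
  wgt J (subst_idx a b J') = wgt J J' - wgtr J a + wgtr J b.
Proof.
move=> aJ bJ ha hb; rewrite !wgt_right -(sum_indicator (wgtr J) ha).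
rewrite -(sum_indicator (wgtr J) hb) -sumrB -big_split.
by apply: eq_bigr => p _ /=; rewrite subst_indicator //; ring.
Qed.

Lemma wgt_bd J :
  wgtl beta J - wgtl beta.+1 J + wgtr J alpha - wgtr J alpha.+1 = 0.
Proof.
rewrite -!sumrB -big_split -sumrB big_nat big1 // => q hq /=.
transitivity ((q \in J)%:R *
    (rho beta q - rho beta.+1 q + rho q alpha - rho q alpha.+1)); first ring.
by rewrite (bd_cond bd) ?mulr0.
Qed.

(** By [bd_sym] each side is an indicator plus a [kappa] term that does not depend on the index and
    so drops out. *)
Lemma wgt_sym J p p' : (1 <= p <= n)%N -> (1 <= p' <= n)%N ->
  wgtl p J + wgtr J p = wgtl p' J + wgtr J p' + (p \in J)%:R - (p' \in J)%:R.
Proof.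
have E r : (1 <= r <= n)%N -> wgtl r J + wgtr J r = (r \in J)%:R
    - \sum_(1 <= q < n.+1) kappa * (q \in J)%:R.
  move=> hr; rewrite -(sum_indicator (fun q => (q \in J)%:R) hr).
  rewrite -sumrB -big_split; apply: eq_big_nat => q hq /=.
  by rewrite -mulrDl (bd_sym bd) // eq_sym; ring.
by move=> hp hp'; rewrite !E //; ring.
Qed.

(** The exponent contributed by the torus part: minors are eigenvectors of the diagonal operators,
    with columns counted positively and rows negatively. *)
Definition wt (IJ IJ' : seq nat * seq nat) : P :=
  wgt IJ.2 IJ'.2 - wgt IJ.1 IJ'.1.

Lemma K_wt IJ IJ' : K (wt IJ IJ').
Proof. by apply: (bd_KB bd); apply: K_wgt. Qed.

Lemma tor_mn I J I' J' : wf I J -> wf I' J' ->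
  tor S rho (mn I J) (mn I' J')
  = wt (I, J) (I', J') * (mn I J * mn I' J').
Proof.
case=> uI uJ sIJ [uI' uJ' sIJ'].
rewrite /wt /wgt /tor /= -sumrB mulr_suml; apply: eq_big_nat => p hp.
rewrite -sumrB mulr_suml; apply: eq_big_nat => q hq.
rewrite !colD_mn // !rowD_mn // !subst_id.
by do 4![case: (_ \in _)]; rewrite /=; ring.
Qed.

Lemma colD_eq0 a b I J : wf I J -> (1 <= a <= n)%N -> a != b ->
  (a \in J -> b \in J) -> colD a b (mn I J) = 0.
Proof.
case=> uI uJ sIJ ha ab aJ; case/boolP: (a \in J) => [/aJ bJ|aJ0].
  exact: colD_mn0.
by rewrite colD_mn // (negbTE aJ0).
Qed.

Lemma rowD_eq0 a b I J : wf I J -> (1 <= b <= n)%N -> a != b ->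
  (b \in I -> a \in I) -> rowD a b (mn I J) = 0.
Proof.
case=> uI uJ sIJ ha ab aJ; case/boolP: (b \in I) => [/aJ bJ|aJ0].
  exact: rowD_mn0.
by rewrite rowD_mn // (negbTE aJ0).
Qed.

Lemma colD_subst a b I J : wf I J -> (1 <= a <= n)%N -> a \in J ->
  colD a b (mn I J) = mn I (subst_idx a b J).
Proof. by case=> uI uJ sIJ ha aJ; rewrite colD_mn // aJ. Qed.

Lemma rowD_subst a b I J : wf I J -> (1 <= b <= n)%N -> b \in I ->
  rowD a b (mn I J) = mn (subst_idx b a I) J.
Proof. by case=> uI uJ sIJ ha aJ; rewrite rowD_mn // aJ. Qed.

Lemma colD_up a b I J : wf I J -> up_closed n J -> (1 <= a)%N -> (a < b)%N ->
  (b <= n)%N -> colD a b (mn I J) = 0.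
Proof. by move=> w u ha ab hb; apply: colD_eq0 => //; [lia | lia | exact: u]. Qed.

Lemma colD_down a b I J : wf I J -> down_closed n J -> (1 <= a)%N ->
  (a < b)%N -> (b <= n)%N -> colD b a (mn I J) = 0.
Proof. by move=> w u ha ab hb; apply: colD_eq0 => //; [lia | lia | exact: u]. Qed.

Lemma rowD_up a b I J : wf I J -> up_closed n I -> (1 <= a)%N -> (a < b)%N ->
  (b <= n)%N -> rowD b a (mn I J) = 0.
Proof. by move=> w u ha ab hb; apply: rowD_eq0 => //; [lia | lia | exact: u]. Qed.

Lemma rowD_down a b I J : wf I J -> down_closed n I -> (1 <= a)%N ->
  (a < b)%N -> (b <= n)%N -> rowD a b (mn I J) = 0.
Proof. by move=> w u ha ab hb; apply: rowD_eq0 => //; [lia | lia | exact: u]. Qed.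

Lemma upC_up I J g : wf I J -> up_closed n J -> upC (mn I J) g = 0.
Proof.
by move=> w u; apply: upper0 => a b ha ab hb; rewrite colD_up ?mul0r.
Qed.

Lemma upC_down I J g : wf I J -> down_closed n J -> upC g (mn I J) = 0.
Proof.
by move=> w u; apply: upper0 => a b ha ab hb; rewrite colD_down ?mulr0.
Qed.

Lemma upR_up I J g : wf I J -> up_closed n I -> upR g (mn I J) = 0.
Proof.
by move=> w u; apply: upper0 => a b ha ab hb; rewrite rowD_up ?mulr0.
Qed.

Lemma upR_down I J g : wf I J -> down_closed n I -> upR (mn I J) g = 0.
Proof.
by move=> w u; apply: upper0 => a b ha ab hb; rewrite rowD_down ?mul0r.
Qed.

Lemma br_mn I J I' J' : wf I J -> wf I' J' ->
  br (mn I J) (mn I' J') = wt (I, J) (I', J') * (mn I J * mn I' J')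
  + (upC (mn I J) (mn I' J') - upR (mn I J) (mn I' J'))
  + (opD (mn I J) * opE (mn I' J') - opE (mn I J) * opD (mn I' J'))
  - (opU (mn I J) * opS (mn I' J') - opS (mn I J) * opU (mn I' J')).
Proof. by move=> w w'; rewrite -tor_mn. Qed.

Lemma br_mn_skew I J I' J' : wf I J -> wf I' J' ->
  br (mn I J) (mn I' J') = - wt (I', J') (I, J) * (mn I J * mn I' J')
  - (upC (mn I' J') (mn I J) - upR (mn I' J') (mn I J))
  + (opD (mn I J) * opE (mn I' J') - opE (mn I J) * opD (mn I' J'))
  - (opU (mn I J) * opS (mn I' J') - opS (mn I J) * opU (mn I' J')).
Proof. by move=> w w'; rewrite br_skew br_mn //; ring. Qed.

(** Skewness puts the minor with up-closed rows second, where its row sum vanishes; this is why the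
    weight appears reversed and negated. *)
Lemma br_bottom I J I' J' : wf I J -> up_closed n I -> wf I' J' ->
  br (mn I J) (mn I' J') = - wt (I', J') (I, J) * (mn I J * mn I' J')
  - upC (mn I' J') (mn I J)
  + opD (mn I J) * opE (mn I' J') - opE (mn I J) * opD (mn I' J')
  - opU (mn I J) * opS (mn I' J').
Proof.
move=> w u w'; rewrite br_mn_skew // upR_up // [opS (mn I J)]rowD_up //; try lia.
ring.
Qed.

(* minB = f_{1,beta+1} and minQ = f_{alpha+1,1}; the letters E, U, S, D prefixed
   to a minor stand for the operator opE, opU, opS, opD applied to it. *)
Definition minB := mn (itv 1 (n - beta)) (itv beta.+1 n).
Definition minEB := mn (itv 1 (n - beta)) (subst_idx beta.+1 beta (itv beta.+1 n)).
Definition minQ := mn (itv alpha.+1 n) (itv 1 (n - alpha)).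
Definition minUQ :=
  mn (subst_idx alpha.+1 alpha (itv alpha.+1 n)) (itv 1 (n - alpha)).

Lemma wf_B : wf (itv 1 (n - beta)) (itv beta.+1 n).
Proof. by apply: wf_itv; lia. Qed.

Lemma wf_EB : wf (itv 1 (n - beta)) (subst_idx beta.+1 beta (itv beta.+1 n)).
Proof. by apply: wf_substr; [exact: wf_B | rewrite mem_itv; lia]. Qed.

Lemma wf_Q : wf (itv alpha.+1 n) (itv 1 (n - alpha)).
Proof. by apply: wf_itv; lia. Qed.

Lemma wf_UQ : wf (subst_idx alpha.+1 alpha (itv alpha.+1 n)) (itv 1 (n - alpha)).
Proof. by apply: wf_substl; [exact: wf_Q | rewrite mem_itv; lia]. Qed.

Lemma opE_B : opE minB = minEB.
Proof. by apply: colD_subst; [exact: wf_B | lia | rewrite mem_itv; lia]. Qed.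

Lemma opU_Q : opU minQ = minUQ.
Proof. by apply: rowD_subst; [exact: wf_Q | lia | rewrite mem_itv; lia]. Qed.

(** The only gap to the right of a column is beta + 1, and only column beta can move into it. *)
Lemma upC_colsEB I g : wf I (itv beta.+1 n) ->
  upC (mn I (subst_idx beta.+1 beta (itv beta.+1 n))) g
  = mn I (itv beta.+1 n) * opE g.
Proof.
move=> w; have wJ : wf I (subst_idx beta.+1 beta (itv beta.+1 n)).
  by apply: wf_substr => //; rewrite mem_itv; lia.
rewrite [upC _ _](@upper1 _ _ _ beta beta.+1); try lia.
  rewrite colD_subst //; try lia; last by rewrite mem_subst !mem_itv; lia.
  by rewrite subst_substK // mem_itv; lia.
move=> a b ha1 ab hb1 nab; rewrite colD_eq0 ?mul0r //; try lia.
by rewrite !mem_subst !mem_itv; lia.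
Qed.

Lemma opD_colsEB I : wf I (itv beta.+1 n) ->
  opD (mn I (subst_idx beta.+1 beta (itv beta.+1 n))) = 0.
Proof.
move=> w; have wJ : wf I (subst_idx beta.+1 beta (itv beta.+1 n)).
  by apply: wf_substr => //; rewrite mem_itv; lia.
by apply: colD_eq0 => //; rewrite ?mem_subst ?mem_itv; lia.
Qed.

(** The rows are left free so that the formula serves both [minB] and, when 2 beta = n, [minSB]. *)
Lemma br_cols_B I I' J' : wf I (itv beta.+1 n) -> wf I' J' ->
  let: f := mn I (itv beta.+1 n) in let: g := mn I' J' in
  br f g = wt (I, itv beta.+1 n) (I', J') * (f * g) - upR f g
    - opE f * opD g - (opU f * opS g - opS f * opU g).
Proof.
move=> w w'; rewrite br_mn // upC_up //; last exact: up_closed_itv.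
rewrite [opD (mn I _)]colD_up //; try lia; last exact: up_closed_itv.
ring.
Qed.

Lemma br_cols_EB I I' J' : wf I (itv beta.+1 n) -> wf I' J' ->
  let: f := mn I (itv beta.+1 n) in let: g := mn I' J' in
  let: J := subst_idx beta.+1 beta (itv beta.+1 n) in
  br (mn I J) g = wt (I, J) (I', J') * (mn I J * g) + f * opE g
    - upR (mn I J) g - (opU (mn I J) * opS g - opS (mn I J) * opU g).
Proof.
move=> w w'; have wJ : wf I (subst_idx beta.+1 beta (itv beta.+1 n)).
  by apply: wf_substr => //; rewrite mem_itv; lia.
rewrite br_mn //.
rewrite opD_colsEB //.
have -> : opE (mn I (subst_idx beta.+1 beta (itv beta.+1 n))) = 0.
  by apply: colD_eq0 => //; rewrite ?mem_subst ?mem_itv; lia.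
rewrite upC_colsEB //.
ring.
Qed.

Lemma br_B I' J' : wf I' J' -> let: g := mn I' J' in
  br minB g = wt (itv 1 (n - beta), itv beta.+1 n) (I', J') * (minB * g)
    - opE minB * opD g + opS minB * opU g.
Proof.
move=> w'; rewrite br_cols_B ?upR_down //; try exact: wf_B;
  last exact: down_closed_itv.
rewrite [opU _]rowD_down; try lia; [|exact: wf_B|exact: down_closed_itv].
rewrite -/minB; ring.
Qed.

Lemma br_EB I' J' : wf I' J' -> let: g := mn I' J' in
  br minEB g = wt (itv 1 (n - beta), subst_idx beta.+1 beta (itv beta.+1 n))
      (I', J') * (minEB * g)
    + minB * opE g + opS minEB * opU g.
Proof.
move=> w'; rewrite br_cols_EB ?upR_down //; try exact: wf_B; try exact: wf_EB;
  last exact: down_closed_itv.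
rewrite [opU _]rowD_down; try lia; [|exact: wf_EB|exact: down_closed_itv].
rewrite -/minB -/minEB; ring.
Qed.

(** Replacing row beta by beta + 1 in the rows [1, n - beta] gives something nonzero only if these
    rows end in beta. *)
Lemma opS_B0 : beta.*2 != n -> opS minB = 0.
Proof.
by move=> h; apply: rowD_eq0; [exact: wf_B | lia | lia | rewrite !mem_itv; lia].
Qed.

Lemma opS_EB0 : beta.*2 != n -> opS minEB = 0.
Proof.
by move=> h; apply: rowD_eq0; [exact: wf_EB | lia | lia | rewrite !mem_itv; lia].
Qed.

(** * The case 2 beta = n *)

Section BetaHalf.
Hypothesis beta_half : beta.*2 = n.

Let rowsSB := subst_idx beta beta.+1 (itv 1 (n - beta)).
Definition minSB := mn rowsSB (itv beta.+1 n).
Definition minESB := mn rowsSB (subst_idx beta.+1 beta (itv beta.+1 n)).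

Lemma wf_SB : wf rowsSB (itv beta.+1 n).
Proof. by apply: wf_substl; [exact: wf_B | rewrite mem_itv; lia]. Qed.

Lemma wf_ESB : wf rowsSB (subst_idx beta.+1 beta (itv beta.+1 n)).
Proof. by apply: wf_substr; [exact: wf_SB | rewrite mem_itv; lia]. Qed.

Lemma opS_B : opS minB = minSB.
Proof. by apply: rowD_subst; [exact: wf_B | lia | rewrite mem_itv; lia]. Qed.

Lemma opS_EB : opS minEB = minESB.
Proof. by apply: rowD_subst; [exact: wf_EB | lia | rewrite mem_itv; lia]. Qed.

Lemma opE_SB : opE minSB = minESB.
Proof. by apply: colD_subst; [exact: wf_SB | lia | rewrite mem_itv; lia]. Qed.

Lemma upR_rowsSB J g : wf (itv 1 (n - beta)) J ->
  upR (mn rowsSB J) g = mn (itv 1 (n - beta)) J * opS g.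
Proof.
move=> w; have w' : wf rowsSB J by apply: wf_substl => //; rewrite mem_itv; lia.
rewrite [upR _ _](@upper1 _ _ _ beta beta.+1); try lia.
  rewrite rowD_subst //; try lia; last by rewrite mem_subst !mem_itv; lia.
  by rewrite subst_substK // mem_itv; lia.
move=> a b ha1 ab hb1 nab; rewrite rowD_eq0 ?mul0r //; try lia.
by rewrite !mem_subst !mem_itv; lia.
Qed.

(** Apart from row 1, only row beta + 1 lacks its predecessor here, and alpha differs from beta. *)
Lemma opU_rowsSB J : wf rowsSB J -> opU (mn rowsSB J) = 0.
Proof.
move=> w; apply: rowD_eq0 => //; try lia.
by rewrite !mem_subst !mem_itv; lia.
Qed.

Lemma opS_rowsSB J : wf rowsSB J -> opS (mn rowsSB J) = 0.
Proof.
move=> w; apply: rowD_eq0 => //; try lia.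
by rewrite !mem_subst !mem_itv; lia.
Qed.

Lemma br_SB I' J' : wf I' J' -> let: g := mn I' J' in
  br minSB g = wt (rowsSB, itv beta.+1 n) (I', J') * (minSB * g)
    - minESB * opD g - minB * opS g.
Proof.
move=> w'; rewrite br_cols_B ?upR_rowsSB ?opU_rowsSB ?opS_rowsSB //;
  try exact: wf_SB; try exact: wf_B.
rewrite -/minSB opE_SB -/minB; ring.
Qed.

Lemma br_ESB I' J' : wf I' J' -> let: g := mn I' J' in
  br minESB g = wt (rowsSB, subst_idx beta.+1 beta (itv beta.+1 n))
      (I', J') * (minESB * g)
    + minSB * opE g - minEB * opS g.
Proof.
move=> w'; rewrite br_cols_EB ?upR_rowsSB ?opU_rowsSB ?opS_rowsSB //;
  try exact: wf_SB; try exact: wf_EB; try exact: wf_ESB.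
rewrite -/minSB -/minESB -/minEB; ring.
Qed.

End BetaHalf.

(** * Brackets with f_{alpha+1,1} when 2 alpha != n *)

Section AlphaNotHalf.
Hypothesis alpha_half : alpha.*2 != n.

Lemma opD_rowsQ I : wf I (itv 1 (n - alpha)) ->
  opD (mn I (itv 1 (n - alpha))) = 0.
Proof. by move=> w; apply: colD_eq0 => //; rewrite ?mem_itv; lia. Qed.

Lemma opE_rowsQ I : wf I (itv 1 (n - alpha)) ->
  opE (mn I (itv 1 (n - alpha))) = 0.
Proof. by move=> w; apply: colD_eq0 => //; rewrite ?mem_itv; lia. Qed.

Lemma opS_Q : opS minQ = 0.
Proof. by apply: rowD_eq0; [exact: wf_Q | lia | lia | rewrite !mem_itv; lia]. Qed.

Lemma opS_UQ : opS minUQ = 0.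
Proof.
by apply: rowD_eq0; [exact: wf_UQ | lia | lia | rewrite !mem_subst !mem_itv; lia].
Qed.

Lemma opU_UQ : opU minUQ = 0.
Proof.
by apply: rowD_eq0; [exact: wf_UQ | lia | lia | rewrite !mem_subst !mem_itv; lia].
Qed.

Lemma br_Q I' J' : wf I' J' -> let: g := mn I' J' in
  br minQ g = - wt (I', J') (itv alpha.+1 n, itv 1 (n - alpha)) * (minQ * g)
    - minUQ * opS g.
Proof.
move=> w'; rewrite br_bottom //; [|exact: wf_Q|exact: up_closed_itv].
rewrite upC_down; [|exact: wf_Q|exact: down_closed_itv].
rewrite opD_rowsQ ?opE_rowsQ; try exact: wf_Q.
rewrite -/minQ opU_Q; ring.
Qed.

Lemma br_UQ I' J' : wf I' J' -> let: g := mn I' J' in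
  br minUQ g = - wt (I', J')
      (subst_idx alpha.+1 alpha (itv alpha.+1 n), itv 1 (n - alpha))
      * (minUQ * g) + minQ * opU g.
Proof.
move=> w'; rewrite br_mn_skew //; last exact: wf_UQ.
rewrite upC_down; [|exact: wf_UQ|exact: down_closed_itv].
rewrite opD_rowsQ ?opE_rowsQ; try exact: wf_UQ.
rewrite -/minUQ opU_UQ opS_UQ.
(* The rows of [minUQ] have the single gap alpha + 1, which only row alpha can fill. *)
have -> : upR (mn I' J') minUQ = opU (mn I' J') * minQ.
  rewrite [upR _ _](@upper1 _ _ _ alpha alpha.+1); try lia.
    rewrite [rowD _ _ minUQ]rowD_subst; [|exact: wf_UQ|lia|]; last first.
      by rewrite mem_subst !mem_itv; lia.
    by rewrite subst_substK // mem_itv; lia.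
  move=> a b ha1 ab hb1 nab.
  rewrite [rowD _ _ minUQ]rowD_eq0 ?mulr0 //; try lia; first exact: wf_UQ.
  by rewrite !mem_subst !mem_itv; lia.
ring.
Qed.

End AlphaNotHalf.

(** ** Brackets with theta *)

Lemma br_Ml u v g : br (u * v) g = br u g * v + u * br v g.
Proof.
rewrite !(br_skew g) (derivationM _ _ (br_der S alpha beta rho g)); ring.
Qed.

Lemma br_Bl u v g : br (u - v) g = br u g - br v g.
Proof.
rewrite !(br_skew g) (derivationB _ _ (br_der S alpha beta rho g)); ring.
Qed.

Lemma br_Mr g u v : br g (u * v) = br g u * v + u * br g v.
Proof. exact: (derivationM _ _ (br_der S alpha beta rho g)). Qed.

Lemma br_Br g u v : br g (u - v) = br g u - br g v.
Proof. exact: (derivationB _ _ (br_der S alpha beta rho g)). Qed.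

(* Bhat is the second factor of the leading term of theta_k: f_{1,beta+1}, or
   psi_1 when 2 beta = n; EBhat is its image under opE. *)
Definition Bhat : P :=
  if beta.*2 == n then minB * minQ - minSB * minUQ else minB.
Definition EBhat : P :=
  if beta.*2 == n then minEB * minQ - minESB * minUQ else minEB.

Let rowsB := itv 1 (n - beta).
Let colsB := itv beta.+1 n.
Let colsEB := subst_idx beta.+1 beta colsB.
Let rowsQ := itv alpha.+1 n.
Let rowsUQ := subst_idx alpha.+1 alpha rowsQ.
Let colsQ := itv 1 (n - alpha).

Definition wtBhat (IJ : seq nat * seq nat) : P :=
  wt (rowsB, colsB) IJ - (if beta.*2 == n then wt IJ (rowsQ, colsQ) else 0).
Definition wtEBhat (IJ : seq nat * seq nat) : P :=
  wt (rowsB, colsEB) IJ - (if beta.*2 == n then wt IJ (rowsQ, colsQ) else 0).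

(** The products B Q and (S B) (U Q) have different weights but the same exponent against any minor:
    the difference is the Belavin-Drinfeld condition on rows. *)
Lemma wt_SB_UQ IJ J : beta.*2 = n ->
  wt (subst_idx beta beta.+1 rowsB, J) IJ - wt IJ (rowsUQ, colsQ)
  = wt (rowsB, J) IJ - wt IJ (rowsQ, colsQ).
Proof.
move=> h; rewrite /wt /= wgt_substl ?mem_itv; try lia.
rewrite wgt_substr ?mem_itv; try lia.
have e := wgt_bd IJ.1.
have -> : wgtl beta.+1 IJ.1
  = wgtl beta IJ.1 + wgtr IJ.1 alpha - wgtr IJ.1 alpha.+1.
  by apply: (addrI (- wgtl beta.+1 IJ.1)); rewrite addNr -e; ring.
ring.
Qed.

(** When 2 beta = n, the terms with [opU g] and [opS g] coming from B Q cancel those coming from (S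
    B) (U Q). *)
Lemma br_Bhat I' J' : wf I' J' -> let: g := mn I' J' in
  br Bhat g = wtBhat (I', J') * (Bhat * g) - EBhat * opD g.
Proof.
move=> w; rewrite /Bhat /wtBhat /EBhat; case: eqP => [h|h].
  have hal : alpha.*2 != n by lia.
  rewrite br_Bl !br_Ml (br_B w) (br_Q hal w) (br_SB h w).
  rewrite (br_UQ hal w) opE_B (opS_B h).
  have e := wt_SB_UQ (I', J') colsB h.
  rewrite -/rowsB -/colsB -/rowsQ -/rowsUQ -/colsQ.
  have -> : wt (subst_idx beta beta.+1 rowsB, colsB) (I', J')
     = wt (rowsB, colsB) (I', J') - wt (I', J') (rowsQ, colsQ)
       + wt (I', J') (rowsUQ, colsQ) by rewrite -e; ring.
  ring.
rewrite (br_B w) opE_B opS_B0; last exact/eqP.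
rewrite -/rowsB -/colsB; ring.
Qed.

Lemma br_EBhat I' J' : wf I' J' -> let: g := mn I' J' in
  br EBhat g = wtEBhat (I', J') * (EBhat * g) + Bhat * opE g.
Proof.
move=> w; rewrite /Bhat /wtEBhat /EBhat; case: eqP => [h|h].
  have hal : alpha.*2 != n by lia.
  rewrite br_Bl !br_Ml (br_EB w) (br_Q hal w) (br_ESB h w).
  rewrite (br_UQ hal w) (opS_EB h).
  have e := wt_SB_UQ (I', J') colsEB h.
  rewrite -/rowsB -/colsB -/colsEB -/rowsQ -/rowsUQ -/colsQ.
  have -> : wt (subst_idx beta beta.+1 rowsB, colsEB) (I', J')
     = wt (rowsB, colsEB) (I', J') - wt (I', J') (rowsQ, colsQ)
       + wt (I', J') (rowsUQ, colsQ) by rewrite -e; ring.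
  ring.
rewrite (br_EB w) opS_EB0; last exact/eqP.
rewrite -/rowsB -/colsB -/colsEB; ring.
Qed.

(* minA k = f_{n+k-alpha,k}, and minDA k is obtained from it by the right shift. *)
Definition minA k := mn (itv (n + k - alpha) n) (itv k alpha).
Definition minDA k :=
  mn (itv (n + k - alpha) n) (subst_idx alpha alpha.+1 (itv k alpha)).

Lemma wf_A k : (k <= alpha)%N -> wf (itv (n + k - alpha) n) (itv k alpha).
Proof. by move=> h; apply: wf_itv; lia. Qed.

Lemma wf_DA k : (k <= alpha)%N ->
  wf (itv (n + k - alpha) n) (subst_idx alpha alpha.+1 (itv k alpha)).
Proof. by move=> h; apply: wf_substr; [exact: wf_A | rewrite mem_itv; lia]. Qed.

Lemma opD_A k : (k <= alpha)%N -> opD (minA k) = minDA k.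
Proof.
by move=> h; apply: colD_subst; [exact: wf_A | lia | rewrite mem_itv; lia].
Qed.

Lemma opD_DA k : (k <= alpha)%N -> opD (minDA k) = 0.
Proof.
move=> h; apply: colD_eq0; [exact: wf_DA | lia | lia |].
by rewrite !mem_subst !mem_itv; lia.
Qed.

Definition thetaB k := minA k * Bhat - minDA k * EBhat.

(** The minus sign comes from [br_bottom], through which the bracket of A with a minor is
    computed. *)
Definition wtTheta k IJ := wtBhat IJ - wt IJ (itv (n + k - alpha) n, itv k alpha).

(** [defE] and [defU] are, up to sign, the coefficients of the residual terms with [opD g] and
    [opS g]. They cancel only between the factors of another theta or psi. *)
Definition defE k := Bhat * opE (minA k) - EBhat * opE (minDA k).
Definition defU k := Bhat * opU (minA k) - EBhat * opU (minDA k).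

Lemma wtTheta_DA k IJ : (k <= alpha)%N -> wtTheta k IJ
  = wtEBhat IJ
    - wt IJ (itv (n + k - alpha) n, subst_idx alpha alpha.+1 (itv k alpha)).
Proof.
move=> hk; rewrite /wtTheta /wtBhat /wtEBhat /wt /=.
rewrite wgt_substl ?mem_itv; try lia.
rewrite wgt_substr ?mem_itv; try lia.
have e := wgt_bd IJ.2.
have -> : wgtl beta.+1 IJ.2
  = wgtl beta IJ.2 + wgtr IJ.2 alpha - wgtr IJ.2 alpha.+1.
  by apply: (addrI (- wgtl beta.+1 IJ.2)); rewrite addNr -e; ring.
ring.
Qed.

(** The terms with [opE g] cancel for every [g]. In the later applications either [opD g] vanishes
    or [upC g (minDA k)] equals [minA k * opD g], which accounts for the grouping. *)
Lemma br_theta k I' J' : (k <= alpha)%N -> wf I' J' -> let: g := mn I' J' in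
  br (thetaB k) g = wtTheta k (I', J') * (thetaB k * g)
    - Bhat * upC g (minA k) + EBhat * (upC g (minDA k) - minA k * opD g)
    - defE k * opD g - defU k * opS g.
Proof.
move=> hk w; rewrite /thetaB br_Bl !br_Ml br_Bhat // br_EBhat //.
have u := @up_closed_itv n (n + k - alpha).
rewrite (br_bottom (wf_A hk) u w) (br_bottom (wf_DA hk) u w).
rewrite -!/(minA k) -!/(minDA k) opD_A // opD_DA // /defE /defU.
have e := wtTheta_DA (I', J') hk.
rewrite /wtTheta in e *.
have -> : wtEBhat (I', J') = wtBhat (I', J')
    - wt (I', J') (itv (n + k - alpha) n, itv k alpha)
    + wt (I', J') (itv (n + k - alpha) n, subst_idx alpha alpha.+1 (itv k alpha)).
  by rewrite e; ring.
ring.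
Qed.

Lemma K_wtBhat IJ : K (wtBhat IJ).
Proof.
apply: (bd_KB bd); first exact: K_wt _ _.
by case: eqP => _; [exact: K_wt _ _ | exact: K0].
Qed.

Lemma K_wtTheta k IJ : K (wtTheta k IJ).
Proof. by apply: (bd_KB bd); [exact: K_wtBhat | exact: K_wt _ _]. Qed.

Let rowsA k := itv (n + k - alpha) n.
Let colsA k := itv k alpha.
Let colsDA k := subst_idx alpha alpha.+1 (colsA k).

(** * Log canonicity of pairs that contain theta *)

Definition lc f g := exists omega, K omega /\ br f g = omega * (f * g).

(** The number of common indices in [1, n]: the diagonal part of the Casimir sum multiplies a
    product of minors by it. *)
Definition cnt (I I' : seq nat) : P :=
  \sum_(1 <= a < n.+1) (a \in I)%:R * (a \in I')%:R.

Lemma K_cnt I I' : K (cnt I I').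
Proof. by apply: (Ksum) => a; rewrite -natrM; apply: Knat _. Qed.

Lemma cnt_subst a b I I' : a \in I -> b \notin I ->
  (1 <= a <= n)%N -> (1 <= b <= n)%N ->
  cnt (subst_idx a b I) I' = cnt I I' - (a \in I')%:R + (b \in I')%:R.
Proof.
move=> aI bI ha1 hb1; rewrite /cnt.
rewrite -(sum_indicator (fun q => (q \in I')%:R) ha1).
rewrite -(sum_indicator (fun q => (q \in I')%:R) hb1) -sumrB -big_split.
by apply: eq_bigr => p _ /=; rewrite subst_indicator //; ring.
Qed.

Lemma casimir_mn I J I' J' : wf I J -> wf I' J' ->
  let: f := mn I J in let: g := mn I' J' in
  upC f g + upC g f + cnt J J' * (f * g)
  = upR f g + upR g f + cnt I I' * (f * g).
Proof.
case=> uI uJ sIJ [uI' uJ' sIJ'].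
have := casimir_upper S (mn I J) (mn I' J').
have -> : \sum_(1 <= a < n.+1) colD a a (mn I J) * colD a a (mn I' J')
    = cnt J J' * (mn I J * mn I' J').
  rewrite mulr_suml; apply: eq_big_nat => a ha1; rewrite !colD_mn // !subst_id.
  by do 2![case: (_ \in _)]; rewrite /=; ring.
have -> : \sum_(1 <= a < n.+1) rowD a a (mn I J) * rowD a a (mn I' J')
    = cnt I I' * (mn I J * mn I' J').
  rewrite mulr_suml; apply: eq_big_nat => a ha1; rewrite !rowD_mn // !subst_id.
  by do 2![case: (_ \in _)]; rewrite /=; ring.
by [].
Qed.

Lemma upC_term0 I J I' J' : wf I J -> wf I' J' ->
  (forall a b, (a < b)%N -> a \in J -> b \notin J -> b \in J' -> a \notin J' ->
     False) -> upC (mn I J) (mn I' J') = 0.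
Proof.
move=> w w' H; apply: upper0 => a b ha1 ab hb1.
case: (boolP ((a \in J) && (b \notin J))) => [/andP[aJ bJ]|h1]; last first.
  rewrite (@colD_eq0 a b I J) ?mul0r //; try lia.
  by move=> aJ; rewrite aJ /= negbK in h1.
case: (boolP ((b \in J') && (a \notin J'))) => [/andP[bJ' aJ']|h2].
  by case: (H a b).
rewrite (@colD_eq0 b a I' J') ?mulr0 //; try lia.
by move=> aJ'; rewrite aJ' /= negbK in h2.
Qed.

Lemma upR_term0 I J I' J' : wf I J -> wf I' J' ->
  (forall a b, (a < b)%N -> b \in I -> a \notin I -> a \in I' -> b \notin I' ->
     False) -> upR (mn I J) (mn I' J') = 0.
Proof.
move=> w w' H; apply: upper0 => a b ha1 ab hb1.
case: (boolP ((b \in I) && (a \notin I))) => [/andP[aJ bJ]|h1]; last first.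
  rewrite (@rowD_eq0 a b I J) ?mul0r //; try lia.
  by move=> aJ; rewrite aJ /= negbK in h1.
case: (boolP ((a \in I') && (b \notin I'))) => [/andP[bJ' aJ']|h2].
  by case: (H a b).
rewrite (@rowD_eq0 b a I' J') ?mulr0 //; try lia.
by move=> aJ'; rewrite aJ' /= negbK in h2.
Qed.

(** Between two intervals, exchanges towards larger columns exist in at most one order of the
    arguments. All row sums vanish, so in the bad order the Casimir identity leaves a difference of
    counts. *)
Lemma upC_bottom i i' j c j' c' :
  wf (itv i n) (itv j c) -> wf (itv i' n) (itv j' c') ->
  let: f := mn (itv i n) (itv j c) in let: g := mn (itv i' n) (itv j' c') in
  exists omega, K omega /\ upC f g = omega * (f * g).
Proof.
move=> w w'; have [jj|jj] := leqP j' j.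
  exists 0; split; first exact: K0.
  by rewrite mul0r upC_term0 // => a b; rewrite !mem_itv; lia.
exists (cnt (itv i n) (itv i' n) - cnt (itv j c) (itv j' c')); split.
  by apply: (bd_KB bd); apply: K_cnt.
have := casimir_mn w w'; rewrite (upR_up _ w (@up_closed_itv n i)).
rewrite (upR_up _ w' (@up_closed_itv n i')) [upC _ (mn (itv i n) _)]upC_term0 //.
  by rewrite addr0 !add0r mulrBl => <-; ring.
by move=> a b; rewrite !mem_itv; lia.
Qed.

Lemma upR_top i p i' p' j j' :
  wf (itv i p) (itv j n) -> wf (itv i' p') (itv j' n) ->
  let: f := mn (itv i p) (itv j n) in let: g := mn (itv i' p') (itv j' n) in
  exists omega, K omega /\ upR f g = omega * (f * g).
Proof.
move=> w w'; have [jj|jj] := leqP i i'.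
  exists 0; split; first exact: K0.
  by rewrite mul0r upR_term0 // => a b; rewrite !mem_itv; lia.
exists (cnt (itv j n) (itv j' n) - cnt (itv i p) (itv i' p')); split.
  by apply: (bd_KB bd); apply: K_cnt.
have := casimir_mn w w'; rewrite (upC_up _ w (@up_closed_itv n j)).
rewrite (upC_up _ w' (@up_closed_itv n j')) [upR _ (mn (itv i p) _)]upR_term0 //.
  by rewrite addr0 !add0r mulrBl => ->; ring.
by move=> a b; rewrite !mem_itv; lia.
Qed.

Lemma br_theta_top k I' J' : (k <= alpha)%N -> wf I' J' -> up_closed n J' ->
  let: g := mn I' J' in
  br (thetaB k) g = wtTheta k (I', J') * (thetaB k * g) - defU k * opS g.
Proof.
move=> hk w u; rewrite br_theta // !upC_up // [opD _]colD_up //; try lia.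
ring.
Qed.

Lemma br_theta_colsEB k I' : (k <= alpha)%N -> wf I' colsB ->
  let: g := mn I' colsEB in
  br (thetaB k) g = wtTheta k (I', colsEB) * (thetaB k * g)
    - mn I' colsB * defE k - defU k * opS g.
Proof.
move=> hk w; have w' : wf I' colsEB.
  by apply: wf_substr => //; rewrite mem_itv; lia.
rewrite br_theta // !upC_colsEB // opD_colsEB //.
rewrite /defE -!/(opE _) -/colsB; ring.
Qed.

(** As k <= l, the only column exchange between A_l and D A_k is alpha against alpha + 1; its value
    cancels the term with [minA k * opD g]. *)
Lemma br_theta_A k l : (k <= l <= alpha)%N ->
  br (thetaB k) (minA l)
  = wtTheta k (rowsA l, colsA l) * (thetaB k * minA l) - defE k * minDA l.
Proof.
move=> kl; have hl : (l <= alpha)%N by lia.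
have hk : (k <= alpha)%N by lia.
rewrite br_theta //; last exact: wf_A _ _.
rewrite [opD _]opD_A // [opS _]rowD_up //; try lia; first last.
- exact: up_closed_itv.
- exact: wf_A _ hl.
have -> : upC (mn (rowsA l) (colsA l)) (minA k) = 0.
  apply: upC_term0; [exact: wf_A _ _|exact: wf_A _ _|].
  by move=> a b; rewrite !mem_itv; lia.
have -> : upC (mn (rowsA l) (colsA l)) (minDA k) = minA k * minDA l.
  rewrite [upC _ _](@upper1 _ _ _ alpha alpha.+1); try lia.
    rewrite -!/(opD _) [opD _]opD_A // mulrC; congr (_ * _).
    rewrite [colD _ _ _](colD_subst _ (J := colsDA k)); first last.
    - by rewrite mem_subst !mem_itv; lia.
    - by lia.
    - exact: wf_DA _ hk.
    by rewrite subst_substK // mem_itv; lia.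
  move=> a b ha1 ab hb1 nab.
  case: (boolP (a \in colsA l)) => al; last first.
    rewrite (colD_eq0 (J := colsA l)) ?mul0r //; try lia.
    exact: wf_A _ hl.
  case: (boolP (b \in colsA l)) => bl.
    rewrite (colD_eq0 (J := colsA l)) ?mul0r //; try lia.
    exact: wf_A _ hl.
  rewrite (colD_eq0 (J := colsDA k)) ?mulr0 //; try lia.
    exact: wf_DA _ hk.
  by move: al bl; rewrite !mem_subst !mem_itv; lia.
rewrite -/(minA l) /rowsA /colsA; ring.
Qed.

Lemma br_theta_DA k l : (k <= l <= alpha)%N ->
  br (thetaB k) (minDA l)
  = wtTheta k (rowsA l, colsDA l) * (thetaB k * minDA l).
Proof.
move=> kl; have hl : (l <= alpha)%N by lia.
have hk : (k <= alpha)%N by lia.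
rewrite br_theta //; last exact: wf_DA _ _.
rewrite [opD _]opD_DA // [opS _]rowD_up //; try lia; first last.
- exact: up_closed_itv.
- exact: wf_DA _ hl.
have -> : upC (mn (rowsA l) (colsDA l)) (minA k) = 0.
  apply: upC_term0; [exact: wf_DA _ _|exact: wf_A _ _|].
  by move=> a b; rewrite !mem_subst !mem_itv; lia.
have -> : upC (mn (rowsA l) (colsDA l)) (minDA k) = 0.
  apply: upC_term0; [exact: wf_DA _ _|exact: wf_DA _ _|].
  by move=> a b; rewrite !mem_subst !mem_itv; lia.
rewrite -/(minDA l) /rowsA /colsDA /colsA; ring.
Qed.

(* For c < alpha the columns [j, c] meet colsA k and colsDA k in the same set,
   so the two components of theta get the same factor. *)
Lemma cnt_colsDA k j c : (c < alpha)%N ->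
  cnt (itv j c) (colsDA k) = cnt (itv j c) (colsA k).
Proof.
move=> hc; apply: eq_bigr => a _; rewrite mem_subst !mem_itv.
case: (boolP (j <= a <= c)%N) => hj; last by rewrite !mul0r.
by congr (_ * _%:R); lia.
Qed.

Lemma upC_interval_A I j c k : wf I (itv j c) -> (k <= alpha)%N ->
  c != alpha -> (k <= j)%N || (alpha < c)%N ->
  upC (mn I (itv j c)) (minA k) = 0 /\ upC (mn I (itv j c)) (minDA k) = 0.
Proof.
move=> w hk hc hj; split; apply: upC_term0 => //.
- exact: wf_A _ _.
- by move=> a b; rewrite !mem_itv; lia.
- exact: wf_DA _ _.
- by move=> a b; rewrite !mem_subst !mem_itv; lia.
Qed.

Lemma upC_A_interval I j c k : wf I (itv j c) -> (k <= alpha)%N ->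
  (c < alpha)%N -> (j <= k)%N ->
  upC (minA k) (mn I (itv j c)) = 0 /\ upC (minDA k) (mn I (itv j c)) = 0.
Proof.
move=> w hk hc hj; split; apply: upC_term0 => //.
- exact: wf_A _ _.
- by move=> a b; rewrite !mem_itv; lia.
- exact: wf_DA _ _.
- by move=> a b; rewrite !mem_subst !mem_itv; lia.
Qed.

(** It suffices that [upC g] multiplies [minA k] and [minDA k] by the same constant. Since c !=
    alpha, the operator [opD] has no last column to move. *)
Lemma br_theta_bottom k i j c : (k <= alpha)%N -> wf (itv i n) (itv j c) ->
  c != alpha -> lc (thetaB k) (mn (itv i n) (itv j c)).
Proof.
move=> hk w hc; set g := mn _ _.
have Dg : opD g = 0 by apply: colD_eq0 => //; rewrite ?mem_itv; lia.
have Sg : opS g = 0 by apply: rowD_up => //; [exact: up_closed_itv | lia | lia].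
have [N [KN [eA eDA]]] : exists N, K N /\ upC g (minA k) = N * (g * minA k)
    /\ upC g (minDA k) = N * (g * minDA k).
  case: (boolP ((k <= j)%N || (alpha < c)%N)) => hj.
    exists 0; split; first exact: K0.
    by rewrite !mul0r; apply: upC_interval_A.
  have [hc' hj'] : (c < alpha)%N /\ (j <= k)%N by lia.
  (* The reversed column sums and all row sums vanish, so the Casimir identity leaves the counts. *)
  exists (cnt (itv i n) (rowsA k) - cnt (itv j c) (colsA k)); split.
    by apply: (bd_KB bd); apply: K_cnt.
  have [z1 z2] := upC_A_interval w hk hc' hj'.
  have wA := wf_A hk; have wDA := wf_DA hk.
  have := casimir_mn w wA; have := casimir_mn w wDA.
  rewrite -/g -!/(minA k) -!/(minDA k) z1 z2 cnt_colsDA //.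
  have uA := @up_closed_itv n (n + k - alpha).
  rewrite (upR_up _ wA uA) (upR_up _ wDA uA).
  rewrite !(upR_up _ w (@up_closed_itv n i)) !addr0 !add0r -/rowsA -/colsA.
  by rewrite !mulrBl => <- <-; split; ring.
exists (wtTheta k (itv i n, itv j c) - N); split.
  by apply: (bd_KB bd) => //; apply: K_wtTheta _ _.
rewrite br_theta // -/g Dg Sg eA eDA /thetaB; ring.
Qed.

Let dQ k : P := (alpha \in rowsA k)%:R - (alpha.+1 \in rowsA k)%:R.

(* Relative to Q the minor UQ exchanges one more row with A k exactly when
   alpha+1 is the first row of A k. *)
Lemma upC_Q_UQ k : (1 <= k <= alpha)%N -> alpha.*2 != n ->
  exists N, K N /\
  [/\ upC minQ (minA k) = N * (minQ * minA k),
      upC minQ (minDA k) = N * (minQ * minDA k),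
      upC minUQ (minA k) = (N + dQ k) * (minUQ * minA k) + opU (minA k) * minQ
    & upC minUQ (minDA k)
      = (N + dQ k) * (minUQ * minDA k) + opU (minDA k) * minQ].
Proof.
move=> hk hal; have hk' : (k <= alpha)%N by lia.
have hc : (n - alpha)%N != alpha by lia.
have wQ := wf_Q; have wUQ := wf_UQ.
have wA := wf_A hk'; have wDA := wf_DA hk'.
have uA := @up_closed_itv n (n + k - alpha).
(* For alpha < n - alpha no column exchange is possible and the rows of A start beyond alpha + 1;
   otherwise the Casimir identity evaluates the sums. *)
have [hna|hna] := ltnP alpha (n - alpha).
  exists 0; split; first exact: K0.
  have hj : (k <= 1)%N || (alpha < n - alpha)%N by rewrite hna orbT.
  have [-> ->] := upC_interval_A wQ hk' hc hj.
  have [-> ->] := upC_interval_A wUQ hk' hc hj.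
  have -> : dQ k = 0.
    by apply/eqP; rewrite subr_eq0 !mem_itv; apply/eqP; congr _%:R; lia.
  rewrite [opU (minA k)]rowD_eq0 //; try lia; last by rewrite !mem_itv; lia.
  rewrite [opU (minDA k)]rowD_eq0 //; try lia; last by rewrite !mem_itv; lia.
  by split; ring.
exists (cnt rowsQ (rowsA k) - cnt colsQ (colsA k)); split.
  by apply: (bd_KB bd); apply: K_cnt.
have hc' : (n - alpha < alpha)%N by lia.
have hj : (1 <= k)%N by lia.
have [z1 z2] := upC_A_interval wQ hk' hc' hj.
have [z3 z4] := upC_A_interval wUQ hk' hc' hj.
(* These are the only row sums that survive in the four Casimir identities below. *)
have eU M J : M = mn (rowsA k) J -> wf (rowsA k) J ->
    upR M minUQ = opU M * minQ.
  move=> -> w; rewrite [upR _ _](@upper1 _ _ _ alpha alpha.+1); try lia.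
    rewrite [rowD _ _ minUQ](rowD_subst _ wUQ); try lia.
      by rewrite subst_substK // mem_itv; lia.
    by rewrite mem_subst !mem_itv; lia.
  move=> a b ha1 ab hb1 nab; rewrite [rowD _ _ minUQ]rowD_eq0 ?mulr0 //; try lia.
  by rewrite !mem_subst !mem_itv; lia.
have cUQ : cnt rowsUQ (rowsA k) = cnt rowsQ (rowsA k) + dQ k.
  rewrite /rowsUQ cnt_subst; first by [rewrite /dQ; ring]; try lia.
    by rewrite mem_itv; lia.
  by rewrite mem_itv; lia.
have := casimir_mn wQ wA; have := casimir_mn wQ wDA.
have := casimir_mn wUQ wA; have := casimir_mn wUQ wDA.
rewrite -!/(minA k) -!/(minDA k) z1 z2 z3 z4.
rewrite -/rowsQ -/rowsUQ -/colsQ !cnt_colsDA // -!/(rowsA k) cUQ.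
rewrite !(upR_up _ wA uA) !(upR_up _ wDA uA).
rewrite !(upR_up _ wQ (@up_closed_itv n alpha.+1)).
rewrite (eU (minA k) _ erefl) // (eU (minDA k) _ erefl) //.
rewrite -/(colsA k) -/colsQ -[mn rowsQ colsQ]/minQ -[mn rowsUQ colsQ]/minUQ.
rewrite !addr0 !add0r => e1 e2 e3 e4; split.
- by apply: (addIr (cnt colsQ (colsA k) * (minQ * minA k))); rewrite e4; ring.
- by apply: (addIr (cnt colsQ (colsA k) * (minQ * minDA k))); rewrite e3; ring.
- by apply: (addIr (cnt colsQ (colsA k) * (minUQ * minA k))); rewrite e2; ring.
- by apply: (addIr (cnt colsQ (colsA k) * (minUQ * minDA k))); rewrite e1; ring.
Qed.

Lemma br_theta_Q_UQ k : (1 <= k <= alpha)%N -> alpha.*2 != n ->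
  exists N, K N /\
  br (thetaB k) minQ
    = (wtTheta k (rowsQ, colsQ) - N) * (thetaB k * minQ) /\
  br (thetaB k) minUQ
    = (wtTheta k (rowsUQ, colsQ) - N - dQ k) * (thetaB k * minUQ)
      - defU k * minQ.
Proof.
move=> hk hal; have hk' : (k <= alpha)%N by lia.
have [N [KN [e1 e2 e3 e4]]] := upC_Q_UQ hk hal.
have wQ := wf_Q; have wUQ := wf_UQ.
exists N; split=> //; split.
  rewrite [br _ minQ](br_theta hk' wQ) -/minQ (opD_rowsQ hal wQ) (opS_Q hal).
  by rewrite e1 e2 /thetaB /rowsQ /colsQ; ring.
rewrite [br _ minUQ](br_theta hk' wUQ) -/minUQ (opD_rowsQ hal wUQ) (opS_UQ hal).
by rewrite e3 e4 /thetaB /defU /rowsUQ /rowsQ /colsQ; ring.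
Qed.
(** The Belavin-Drinfeld condition with its [wgtr] half converted to [wgtl] by symmetry: up to
    indicators, the roots alpha and beta pair equally on the left. *)
Lemma wgtl_roots (I : seq nat) : wgtl beta I = wgtl beta.+1 I + wgtl alpha I
  - wgtl alpha.+1 I + (alpha.+1 \in I)%:R - (alpha \in I)%:R.
Proof.
have e := wgt_bd I.
have e2 : wgtl alpha I + wgtr I alpha = wgtl alpha.+1 I + wgtr I alpha.+1
    + (alpha \in I)%:R - (alpha.+1 \in I)%:R by apply: wgt_sym; lia.
have -> : wgtl alpha I = wgtl alpha.+1 I + wgtr I alpha.+1
    + (alpha \in I)%:R - (alpha.+1 \in I)%:R - wgtr I alpha by rewrite -e2; ring.
by apply/eqP; rewrite -subr_eq0 -e; apply/eqP; ring.
Qed.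

Lemma wgtr_roots (J : seq nat) : wgtr J beta = wgtr J alpha - wgtr J alpha.+1
  + wgtr J beta.+1 - (beta.+1 \in J)%:R + (beta \in J)%:R.
Proof.
have e := wgt_bd J.
have e2 : wgtl beta J + wgtr J beta = wgtl beta.+1 J + wgtr J beta.+1
    + (beta \in J)%:R - (beta.+1 \in J)%:R by apply: wgt_sym; lia.
have -> : wgtr J beta = wgtl beta.+1 J + wgtr J beta.+1
    + (beta \in J)%:R - (beta.+1 \in J)%:R - wgtl beta J by rewrite -e2; ring.
by apply/eqP; rewrite eq_sym -subr_eq0 -e; apply/eqP; ring.
Qed.

(** The shift [dQ k] matches the one that separates the brackets of theta with Q and with U Q, so f
    Q and (S f) (U Q) get equal exponents. *)
Lemma wtTheta_rows k I J : beta \in I -> beta.+1 \notin I ->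
  wtTheta k (I, J) + wtTheta k (rowsQ, colsQ)
  = wtTheta k (subst_idx beta beta.+1 I, J) + wtTheta k (rowsUQ, colsQ) - dQ k.
Proof.
move=> bI bI'; have aQ : alpha.+1 \in rowsQ by rewrite mem_itv; lia.
have aQ' : alpha \notin rowsQ by rewrite mem_itv; lia.
have [ra ra'] : (1 <= alpha <= n)%N /\ (1 <= alpha.+1 <= n)%N by lia.
have [rb rb'] : (1 <= beta <= n)%N /\ (1 <= beta.+1 <= n)%N by lia.
rewrite /wtTheta /wtBhat /wt /= -/(rowsA k) -/(colsA k).
rewrite -/rowsB -/colsB -/rowsQ -/colsQ /rowsUQ.
rewrite !wgt_substl // !wgt_substr //.
have -> : wgtl beta (rowsA k) = wgtl beta.+1 (rowsA k) + wgtl alpha (rowsA k)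
  - wgtl alpha.+1 (rowsA k) - dQ k by rewrite wgtl_roots /dQ; ring.
rewrite (wgtl_roots rowsQ) aQ (negbTE aQ') (wgtr_roots rowsB).
case: eqP => [h|h].
  have -> : beta \in rowsB by rewrite mem_itv; lia.
  have /negbTE-> : beta.+1 \notin rowsB by rewrite mem_itv; lia.
  by rewrite /=; ring.
have -> : (beta.+1 \in rowsB) = (beta \in rowsB) by rewrite !mem_itv; lia.
ring.
Qed.

Lemma wtTheta_cols k l I I' : (k <= l <= alpha)%N ->
  wtTheta k (I, colsA l) + wtTheta k (I', colsB)
  = wtTheta k (I, colsDA l) + wtTheta k (I', colsEB).
Proof.
move=> kl; have aA r : (r <= alpha)%N -> alpha \in colsA r by rewrite mem_itv; lia.
have aA' r : alpha.+1 \notin colsA r by rewrite mem_itv; lia.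
have bB : beta.+1 \in colsB by rewrite mem_itv; lia.
have bB' : beta \notin colsB by rewrite mem_itv; lia.
have [ra ra'] : (1 <= alpha <= n)%N /\ (1 <= alpha.+1 <= n)%N by lia.
have [rb rb'] : (1 <= beta <= n)%N /\ (1 <= beta.+1 <= n)%N by lia.
have [hk hl] : (k <= alpha)%N /\ (l <= alpha)%N by lia.
rewrite /wtTheta /wtBhat /wt /= -/(rowsA k) -/(colsA k).
rewrite -/rowsB -/colsB -/rowsQ -/colsQ /colsDA /colsEB.
rewrite !wgt_substl ?aA // !wgt_substr ?aA //.
rewrite (wgtl_roots (colsA k)) aA // (negbTE (aA' k)).
rewrite (wgtr_roots colsB) bB (negbTE bB').
case: eqP => [h|h]; last ring.
rewrite (wgtl_roots colsQ).
have -> : (alpha.+1 \in colsQ) = (alpha \in colsQ) by rewrite !mem_itv; lia.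
ring.
Qed.

(** The remainders of {theta, f} and {theta, U Q} both carry [defU k] and cancel in f Q - (S f) (U
    Q). Every psi has this shape when 2 alpha != n. *)
Lemma lc_theta_psi k I J : (1 <= k <= alpha)%N -> alpha.*2 != n -> wf I J ->
  up_closed n J -> beta \in I -> beta.+1 \notin I ->
  let: f := mn I J in lc (thetaB k) (f * minQ - opS f * minUQ).
Proof.
move=> hk hal w u bI bI'; have hk' : (k <= alpha)%N by lia.
have wS : wf (subst_idx beta beta.+1 I) J by exact: wf_substl.
have eS : opS (mn I J) = mn (subst_idx beta beta.+1 I) J.
  by apply: rowD_subst => //; lia.
have eSS : opS (mn (subst_idx beta beta.+1 I) J) = 0.
  by apply: rowD_eq0 => //; rewrite ?mem_subst; lia.
have [N [KN [eQ eUQ]]] := br_theta_Q_UQ hk hal.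
rewrite -/rowsQ -/colsQ -/rowsUQ -/(rowsA k) -/(dQ k) in eQ eUQ.
exists (wtTheta k (I, J) + wtTheta k (rowsQ, colsQ) - N); split.
  apply: (bd_KB bd) => //; apply: (KD); exact: K_wtTheta _ _.
rewrite br_Br !br_Mr eQ eUQ eS.
rewrite !(br_theta_top hk') // eS eSS.
have -> : wtTheta k (rowsQ, colsQ)
    = wtTheta k (subst_idx beta beta.+1 I, J) + wtTheta k (rowsUQ, colsQ)
      - dQ k - wtTheta k (I, J) by rewrite -wtTheta_rows //; ring.
ring.
Qed.

Lemma br_theta_Bhat k : (1 <= k <= alpha)%N -> exists N, K N /\
  br (thetaB k) Bhat = (wtTheta k (rowsB, colsB) + N) * (thetaB k * Bhat) /\
  br (thetaB k) EBhat
    = (wtTheta k (rowsB, colsEB) + N) * (thetaB k * EBhat) - defE k * Bhat.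
Proof.
move=> hk; have hk' : (k <= alpha)%N by lia.
have wB := wf_B; have uB := @up_closed_itv n beta.+1.
rewrite /Bhat /EBhat; case: eqP => [h|/eqP h].
  have hal : alpha.*2 != n by lia.
  have bB : beta \in rowsB by rewrite mem_itv; lia.
  have bB' : beta.+1 \notin rowsB by rewrite mem_itv; lia.
  have wSB := wf_SB h.
  have [N [KN [eQ eUQ]]] := br_theta_Q_UQ hk hal.
  rewrite -/rowsQ -/colsQ -/rowsUQ -/(rowsA k) -/(dQ k) in eQ eUQ.
  exists (wtTheta k (rowsQ, colsQ) - N); split.
    by apply: (bd_KB bd) => //; exact: K_wtTheta _ _.
  have eSS : opS minSB = 0 by apply: (opS_rowsSB h).
  have eSSE : opS minESB = 0 by apply: (opS_rowsSB h); apply: (wf_ESB).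
  have r1 := @wtTheta_rows k rowsB colsB bB bB'.
  have r2 := @wtTheta_rows k rowsB colsEB bB bB'.
  have t1 := br_theta_top hk' wB uB.
  have t2 := br_theta_top hk' wSB uB.
  have t3 := br_theta_colsEB hk' wB.
  have t4 := br_theta_colsEB hk' wSB.
  rewrite -/minB (opS_B h) in t1; rewrite -/minSB eSS in t2.
  rewrite -/minEB (opS_EB h) in t3; rewrite -/minSB -/minESB eSSE in t4.
  rewrite !br_Br !br_Mr eQ eUQ t1 t2 t3 t4 -/rowsB -/colsB -/colsEB.
  rewrite -[mn rowsB colsB]/minB -[mn (subst_idx beta _ rowsB) colsB]/minSB.
  rewrite -[mn (subst_idx beta _ rowsB) colsEB]/minESB.
  rewrite -/rowsB -/colsB -/colsEB in r1 r2.
  split.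
    have -> : wtTheta k (rowsB, colsB) = wtTheta k
        (subst_idx beta beta.+1 rowsB, colsB) + wtTheta k (rowsUQ, colsQ)
        - dQ k - wtTheta k (rowsQ, colsQ) by rewrite -r1; ring.
    ring.
  have -> : wtTheta k (rowsB, colsEB) = wtTheta k
      (subst_idx beta beta.+1 rowsB, colsEB) + wtTheta k (rowsUQ, colsQ)
      - dQ k - wtTheta k (rowsQ, colsQ) by rewrite -r2; ring.
  ring.
exists 0; split; first exact: K0.
have t1 := br_theta_top hk' wB uB.
have t3 := br_theta_colsEB hk' wB.
rewrite -/minB (opS_B0 h) in t1; rewrite -/minEB (opS_EB0 h) in t3.
by rewrite t1 t3 -[mn _ _]/minB; split; rewrite /rowsB /colsEB /colsB; ring.
Qed.

(** The remainder [defE k * minDA l] of the bracket with A_l, multiplied by [Bhat], cancels the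
    remainder [defE k * Bhat] of the bracket with [EBhat], multiplied by [minDA l]. *)
Lemma lc_theta_theta_le k l : (1 <= k)%N -> (k <= l <= alpha)%N ->
  lc (thetaB k) (thetaB l).
Proof.
move=> k1 kl; have hk : (1 <= k <= alpha)%N by lia.
have [N [KN [e1 e2]]] := br_theta_Bhat hk.
exists (wtTheta k (rowsA l, colsA l) + (wtTheta k (rowsB, colsB) + N)); split.
  by apply: (KD); [|apply: (KD)] => //; exact: K_wtTheta _ _.
rewrite [thetaB l in LHS]/thetaB br_Br !br_Mr.
rewrite e1 e2 (br_theta_A kl) (br_theta_DA kl).
rewrite -/(rowsA l) -/(colsA l) -/(colsDA l) [thetaB l]/thetaB.
have -> : wtTheta k (rowsA l, colsDA l)
    = wtTheta k (rowsA l, colsA l) + wtTheta k (rowsB, colsB)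
      - wtTheta k (rowsB, colsEB) by rewrite (wtTheta_cols _ _ kl); ring.
by move: (thetaB k) => th; ring.
Qed.

Lemma lc_sym f g : lc f g -> lc g f.
Proof.
move=> [w [Kw e]]; exists (- w); split; first exact: KN _ _.
by rewrite br_skew e; ring.
Qed.

Lemma lc_theta_theta k l : (1 <= k <= alpha)%N -> (1 <= l <= alpha)%N ->
  lc (thetaB k) (thetaB l).
Proof.
move=> hk hl; have [kl|lk] := leqP k l; first by apply: lc_theta_theta_le; lia.
by apply: lc_sym; apply: lc_theta_theta_le; lia.
Qed.

(** The last row of such a corner is beta exactly at the positions of psi, and otherwise [opS] kills
    the corner. *)
Lemma ordinary_top i j : ordinary i j -> (i <= j)%N ->
  wf (itv i (n + i - j)) (itv j n) /\
  opS (mn (itv i (n + i - j)) (itv j n)) = 0.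
Proof.
rewrite /ordinary => o ij; have w : wf (itv i (n + i - j)) (itv j n).
  by apply: wf_itv; lia.
by split=> //; apply: rowD_eq0 => //; rewrite ?mem_itv; lia.
Qed.

(** The last column is alpha exactly at the positions of theta. *)
Lemma ordinary_bottom i j : ordinary i j -> (j <= i)%N ->
  wf (itv i n) (itv j (n - i + j)) /\ (n - i + j != alpha)%N.
Proof.
by rewrite /ordinary => o ij; split; [apply: wf_itv; lia | lia].
Qed.

Lemma lc_theta_corner k i j : (1 <= k <= alpha)%N -> ordinary i j ->
  lc (thetaB k) (corner i j).
Proof.
move=> hk o; have hk' : (k <= alpha)%N by lia.
have iN : (i <= n)%N by move: o; rewrite /ordinary; lia.
have [ij|ji] := leqP i j.
  have [w s] := ordinary_top o ij; rewrite corner_top //.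
  exists (wtTheta k (itv i (n + i - j), itv j n)); split.
    exact: K_wtTheta _ _.
  rewrite br_theta_top ?s ?mulr0 ?subr0 //; exact: up_closed_itv.
have [w s] := ordinary_bottom o (ltnW ji); rewrite corner_bottom ?(ltnW ji) //.
exact: (br_theta_bottom hk' w s).
Qed.

Lemma br_no_extra I J I' J' : wf I J -> wf I' J' ->
  opD (mn I J) = 0 -> opS (mn I J) = 0 ->
  opD (mn I' J') = 0 -> opS (mn I' J') = 0 ->
  br (mn I J) (mn I' J') = wt (I, J) (I', J') * (mn I J * mn I' J')
    + upC (mn I J) (mn I' J') - upR (mn I J) (mn I' J').
Proof. by move=> w w' d1 s1 d2 s2; rewrite br_mn // d1 s1 d2 s2; ring. Qed.

(** For a top and a bottom corner both sums vanish because the columns of one and the rows of the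
    other are up-closed. Two corners of the same kind need the Casimir identity. *)
Lemma lc_corner i j i' j' : ordinary i j -> ordinary i' j' ->
  lc (corner i j) (corner i' j').
Proof.
have iN a b : ordinary a b -> (a <= n)%N by rewrite /ordinary; lia.
have Dtop I a : wf I (itv a n) -> opD (mn I (itv a n)) = 0.
  by move=> w; apply: colD_up; rewrite ?mem_itv //; [exact: up_closed_itv|lia|lia].
have Sbot J a : wf (itv a n) J -> opS (mn (itv a n) J) = 0.
  by move=> w; apply: rowD_up; rewrite ?mem_itv //; [exact: up_closed_itv|lia|lia].
have Dbot a c b : wf (itv a n) (itv b c) -> c != alpha ->
    opD (mn (itv a n) (itv b c)) = 0.
  by move=> w hc; apply: colD_eq0 => //; rewrite ?mem_itv; lia.
have top_bottom a b a' b' : ordinary a b -> ordinary a' b' ->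
    (a <= b)%N -> (b' <= a')%N -> lc (corner a b) (corner a' b').
  move=> o o' ab ba; have [w s] := ordinary_top o ab.
  have [w' s'] := ordinary_bottom o' ba.
  rewrite corner_top // corner_bottom ?(iN _ _ o') //.
  exists (wt (itv a (n + a - b), itv b n) (itv a' n, itv b' (n - a' + b'))).
  split; first exact: K_wt _ _.
  rewrite br_no_extra ?Dtop ?Sbot ?Dbot //.
  rewrite (upC_up _ w (@up_closed_itv n b)).
  by rewrite (upR_up _ w' (@up_closed_itv n a')); ring.
move=> o o'.
have [ij|/ltnW ji] := leqP i j; have [ij'|/ltnW ji'] := leqP i' j'.
- have [w s] := ordinary_top o ij; have [w' s'] := ordinary_top o' ij'.
  rewrite !corner_top //; have [N [KN e]] := upR_top w w'.
  exists (wt (itv i (n + i - j), itv j n) (itv i' (n + i' - j'), itv j' n) - N).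
  split; first by apply: (bd_KB bd) => //; exact: K_wt _ _.
  rewrite br_no_extra ?Dtop // e (upC_up _ w (@up_closed_itv n j)); ring.
- exact: top_bottom.
- by apply: lc_sym; apply: top_bottom.
- have [w s] := ordinary_bottom o ji; have [w' s'] := ordinary_bottom o' ji'.
  rewrite !corner_bottom ?(iN _ _ o) ?(iN _ _ o') //.
  have [N [KN e]] := upC_bottom w w'.
  exists (wt (itv i n, itv j (n - i + j)) (itv i' n, itv j' (n - i' + j')) + N).
  split; first by apply: (KD) => //; exact: K_wt _ _.
  by rewrite br_no_extra ?Sbot ?Dbot // e (upR_up _ w' (@up_closed_itv n i')); ring.
Qed.

End BelavinDrinfeld.

(** * Transposition *)

Section Transposition.
Variables (P : comNzRingType) (n alpha beta : nat) (S : biaction P n).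
Variables (K : P -> Prop) (rho : nat -> nat -> P) (kappa : P).
Hypothesis bd : bd_form n alpha beta K rho kappa.

Let alpha_range : (1 <= alpha < n)%N := bd_alpha bd.
Let beta_range : (1 <= beta < n)%N := bd_beta bd.

Lemma lc_transpose f g :
  lc beta alpha (transpose S) K (fun p q => rho q p) f g ->
  lc alpha beta S K rho g f.
Proof.
move=> [w [Kw e]]; exists (- w); split; first exact: KN bd _ _.
by rewrite -[br S alpha beta rho g f]opprK -br_transpose e; ring.
Qed.

(** For 2 alpha != n the transposed [Bhat] is Q, so the transposed theta is f Q - (S f) (U Q) with f
    = f_{m,n+m-beta}. *)
Lemma lc_theta_thetaT k m : (1 <= k <= alpha)%N -> (1 <= m <= beta)%N ->
  alpha.*2 != n ->
  lc alpha beta S K rho (thetaB alpha beta S k) (thetaB beta alpha (transpose S) m).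
Proof.
move=> hk hm hal.
have w : wf (itv m beta) (itv (n + m - beta) n) by apply: wf_itv; lia.
have bI : beta \in itv m beta by rewrite mem_itv; lia.
have bI' : beta.+1 \notin itv m beta by rewrite mem_itv; lia.
have := lc_theta_psi S bd hk hal w (@up_closed_itv n _) bI bI'.
have -> // : mn S (itv m beta) (itv (n + m - beta) n) * minQ alpha S
    - opS S beta (mn S (itv m beta) (itv (n + m - beta) n)) * minUQ alpha S
  = thetaB beta alpha (transpose S) m.
rewrite /thetaB /Bhat /EBhat (negbTE hal) /minA /minDA.
rewrite /minB /minEB !mn_transpose ?size_subst ?size_itv; try lia.
congr (_ - _ * _); apply: rowD_subst => //; lia.
Qed.

End Transposition.

Definition log_family (P : comNzRingType) n alpha beta (S : biaction P n)
    (p : P) : Prop :=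
  [\/ exists i j, ordinary n alpha beta i j /\ p = corner S i j,
      exists k, (1 <= k <= alpha)%N /\ p = thetaB alpha beta S k
    | exists m, (1 <= m <= beta)%N /\ p = thetaB beta alpha (transpose S) m].

Lemma lc_family (P : comNzRingType) n alpha beta (S : biaction P n)
    (K : P -> Prop) rho kappa (bd : bd_form n alpha beta K rho kappa) p q :
  log_family alpha beta S p -> log_family alpha beta S q ->
  lc alpha beta S K rho p q.
Proof.
have bdT := bd_transpose bd.
have ordT i j : ordinary n alpha beta i j -> ordinary n beta alpha j i.
  by rewrite /ordinary; lia.
have cornT i j : ordinary n alpha beta i j ->
    corner S i j = corner (transpose S) j i.
  by rewrite /ordinary => o; rewrite corner_transpose //; lia.
have lcs := lc_sym bd.
have lct := lc_transpose bd.
have theta_psi k m : (1 <= k <= alpha)%N -> (1 <= m <= beta)%N ->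
    lc alpha beta S K rho (thetaB alpha beta S k)
      (thetaB beta alpha (transpose S) m).
  move=> hk hm; case: (eqVneq alpha.*2 n) => hal; last first.
    exact: (lc_theta_thetaT S bd).
  (* If 2 alpha = n then 2 beta != n, and the transposed statement applies. *)
  apply: lct; apply: (lc_theta_thetaT (transpose S) bdT) => //.
  by have := bd_neq bd; lia.
case=> [[i [j [o ->]]]|[k [hk ->]]|[m [hm ->]]];
case=> [[i' [j' [o' ->]]]|[k' [hk' ->]]|[m' [hm' ->]]].
- exact: (lc_corner S bd).
- by apply: lcs; apply: (lc_theta_corner S bd).
- apply: lct; rewrite cornT //; apply: (lc_theta_corner (transpose S) bdT) => //.
  exact: ordT.
- exact: (lc_theta_corner S bd).
- exact: (lc_theta_theta S bd).
- exact: theta_psi.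
- apply: lcs; apply: lct; rewrite cornT //.
  by apply: (lc_theta_corner (transpose S) bdT) => //; exact: ordT.
- by apply: lcs; apply: theta_psi.
- by apply: lct; apply: (lc_theta_theta (transpose S) bdT).
Qed.

(** * The bracket on polynomials in the matrix entries *)

Section Rationals.
Variable F : fieldType.
Hypothesis charF : [pchar F] =i pred0.

Definition is_rational (c : F) : Prop :=
  exists a b : int, b != 0 /\ c * b%:~R = a%:~R.

Lemma intr_neq0 (b : int) : b != 0 -> b%:~R != 0 :> F.
Proof.
move=> b0; have natF m : m != 0%N -> m%:R != 0 :> F.
  by move=> m0; rewrite ((pcharf0P F).1 charF).
case: b b0 => m b0; first exact: natF.
by rewrite NegzE intrN oppr_eq0; apply: natF.
Qed.

Lemma is_rational_ratr c : is_rational c -> exists w : rat, c = ratr w.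
Proof.
case=> a [b [b0 e]]; exists (a%:Q / b%:Q); set w := (_ / _ : rat).
have bF := intr_neq0 b0; have dF := intr_neq0 (denq_neq0 w).
have -> : c = a%:~R / b%:~R by rewrite -e mulfK.
(* [ratr w] uses the reduced fraction of [w], while a / b need not be reduced; cross-multiplication
   leaves an integer identity, which is checked in [rat]. *)
apply/eqP; rewrite /ratr eqr_div // -!intrM; apply/eqP; congr _%:~R.
apply: (intr_inj (R := rat)); rewrite !intrM.
have bQ : b%:Q != 0 by rewrite intr_eq0.
have -> : a%:Q = w * b%:Q by rewrite /w mulfVK.
by rewrite numqE; ring.
Qed.

Lemma is_rational_int (a : int) : is_rational a%:~R.
Proof. by exists a, 1; rewrite mulr1. Qed.

Lemma is_rational_nat (m : nat) : is_rational m%:R.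
Proof. exact: (is_rational_int (Posz m)). Qed.

Lemma is_rationalM c d : is_rational c -> is_rational d -> is_rational (c * d).
Proof.
move=> [a [b [b0 e]]] [a' [b' [b0' e']]]; exists (a * a'), (b * b').
by rewrite mulf_neq0 // !intrM -e -e'; split=> //; ring.
Qed.

Lemma is_rationalB c d : is_rational c -> is_rational d -> is_rational (c - d).
Proof.
move=> [a [b [b0 e]]] [a' [b' [b0' e']]]; exists (a * b' - a' * b), (b * b').
by rewrite mulf_neq0 // intrB !intrM -e -e'; split=> //; ring.
Qed.

Lemma is_rationalD c d : is_rational c -> is_rational d -> is_rational (c + d).
Proof.
move=> hc hd; rewrite -[d]opprK -[- d]sub0r; apply: is_rationalB => //.
by apply: is_rationalB => //; apply: (is_rational_int 0).
Qed.

Lemma is_rational_invn m : (0 < m)%N -> is_rational m%:R^-1.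
Proof.
move=> m0; have b0 : (m : int) != 0 by rewrite eqz_nat; lia.
by exists 1, (m : int); split=> //; rewrite mulVf //; apply: (intr_neq0 b0).
Qed.

Lemma is_rational_sum (r : seq nat) (G : nat -> F) :
  (forall i, is_rational (G i)) -> is_rational (\sum_(i <- r) G i).
Proof.
move=> H; elim: r => [|i r IH].
  by rewrite big_nil; apply: (is_rational_int 0).
by rewrite big_cons; apply: is_rationalD.
Qed.

End Rationals.

(** * The coefficients of r_0 *)

Section TorusForm.
Variables (F : fieldType) (n : nat).
Hypothesis charF : [pchar F] =i pred0.

Definition hcoef (i p : nat) : F :=
  n%:R^-1 * (if (p <= i)%N then n%:R - i%:R else - i%:R).

Definition r0coef (alpha beta p q : nat) : F :=
  \sum_(1 <= i < n) hcoef i p * hcoef i q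
  - \sum_(1 <= i < n.-1) hcoef i.+1 p * hcoef i q
  + (if beta == alpha.+1 then 0 else
       (hcoef alpha p * hcoef beta q - hcoef beta p * hcoef alpha q)
       + (hcoef beta.-1 p * hcoef alpha q - hcoef alpha p * hcoef beta.-1 q)
       + (hcoef beta p * hcoef alpha.+1 q - hcoef alpha.+1 p * hcoef beta q)).

Lemma is_rational_hcoef i p : (0 < n)%N -> is_rational (hcoef i p).
Proof.
move=> n0; apply: is_rationalM; first exact: is_rational_invn.
by case: ifP => _; last rewrite -sub0r; apply: is_rationalB;
  rewrite -?[0]/(0%:R); apply: is_rational_nat.
Qed.

Lemma is_rational_r0coef alpha beta p q : (0 < n)%N ->
  is_rational (r0coef alpha beta p q).
Proof.
move=> n0; have R i j k l : is_rational (hcoef i j * hcoef k l).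
  by apply: is_rationalM; apply: is_rational_hcoef.
apply: is_rationalD; last first.
  case: ifP => _; first exact: (is_rational_nat F 0).
  by do ![apply: is_rationalB | apply: is_rationalD]; apply: R.
by apply: is_rationalB; apply: is_rational_sum => i; apply: R.
Qed.

Lemma hcoefE i p : (0 < n)%N -> hcoef i p = (p <= i)%N%:R - i%:R / n%:R.
Proof.
move=> n0; have nF : n%:R != 0 :> F by rewrite ((pcharf0P F).1 charF) // -lt0n.
by rewrite /hcoef; case: leqP => _ /=; field.
Qed.

(** The [h i] are the fundamental coweights, dual to the simple roots. *)
Lemma hcoef_root i p : (0 < n)%N -> hcoef i p - hcoef i p.+1 = (i == p)%:R.
Proof.
move=> n0; rewrite !hcoefE //.
have -> : (p <= i)%N = (p < i)%N || (i == p) by rewrite leq_eqVlt eq_sym orbC.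
by case: ltngtP => _ /=; ring.
Qed.

Lemma hcoef_step i p : (0 < n)%N ->
  hcoef i.+1 p - hcoef i p = (i.+1 == p)%:R - n%:R^-1.
Proof.
move=> n0; rewrite !hcoefE // -[in i.+1%:R]addn1 natrD.
have -> : (p <= i.+1)%N = (p <= i)%N || (i.+1 == p).
  by rewrite leq_eqVlt ltnS eq_sym orbC.
have : ~~ ((p <= i)%N && (i.+1 == p)) by lia.
by case: (p <= i)%N; case: (i.+1 == p) => //= _; ring.
Qed.

(** Summation by parts; it is used with the h_i, which vanish for i = 0 and i = n. *)
Lemma cartan_sum (H G : nat -> F) m : H 0%N = 0 -> G 0%N = 0 ->
  H m.+2 = 0 -> G m.+2 = 0 ->
  (\sum_(1 <= i < m.+2) H i * G i - \sum_(1 <= i < m.+1) H i.+1 * G i)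
  + (\sum_(1 <= i < m.+2) G i * H i - \sum_(1 <= i < m.+1) G i.+1 * H i)
  = \sum_(1 <= i < m.+3) (H i - H i.-1) * (G i - G i.-1).
Proof.
move=> H0 G0 Hm Gm; rewrite !big_add1 /=.
have -> : \sum_(0 <= i < m.+2) (H i.+1 - H i) * (G i.+1 - G i)
  = \sum_(0 <= i < m.+2) H i.+1 * G i.+1 + \sum_(0 <= i < m.+2) H i * G i
    - \sum_(0 <= i < m.+2) H i.+1 * G i - \sum_(0 <= i < m.+2) G i.+1 * H i.
  by rewrite -big_split -!sumrB; apply: eq_bigr => i _ /=; ring.
rewrite [\sum_(0 <= i < m.+2) H i.+1 * G i.+1]big_nat_recr //= Hm mul0r addr0.
rewrite [\sum_(0 <= i < m.+2) H i * G i]big_nat_recl //= H0 mul0r add0r.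
rewrite [\sum_(0 <= i < m.+2) H i.+1 * G i]big_nat_recl //= G0 mulr0 add0r.
rewrite [\sum_(0 <= i < m.+2) G i.+1 * H i]big_nat_recl //= H0 mulr0 add0r.
rewrite [\sum_(0 <= i < m.+1) H i.+2 * G i.+1]big_nat_recr //= Hm mul0r addr0.
rewrite [\sum_(0 <= i < m.+1) G i.+2 * H i.+1]big_nat_recr //= Gm mul0r addr0.
have -> : \sum_(0 <= i < m.+1) G i.+1 * H i.+1
    = \sum_(0 <= i < m.+1) H i.+1 * G i.+1.
  by apply: eq_bigr => i _; rewrite mulrC.
ring.
Qed.

(** Summation by parts gives the sum over i of (delta_ip - 1/n) (delta_iq - 1/n), which is delta_pq
    - 1/n: the origin of [kappa]. The epsilon terms are antisymmetric. *)
Lemma r0coef_sym alpha beta p q : (2 <= n)%N ->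
  (1 <= p <= n)%N -> (1 <= q <= n)%N ->
  r0coef alpha beta p q + r0coef alpha beta q p = (p == q)%:R - n%:R^-1.
Proof.
move=> n2 hp hq; have n0 : (0 < n)%N by lia.
have nF : n%:R != 0 :> F by rewrite ((pcharf0P F).1 charF) // -lt0n.
have [h0 hn] : (forall r, (1 <= r <= n)%N -> hcoef 0 r = 0) /\
    (forall r, (1 <= r <= n)%N -> hcoef n r = 0).
  split=> r /andP[r1 r2]; rewrite hcoefE // ?r2 ?divff ?subrr //.
  by rewrite leqNgt r1 mul0r subrr.
have cs : (\sum_(1 <= i < n) hcoef i p * hcoef i q
     - \sum_(1 <= i < n.-1) hcoef i.+1 p * hcoef i q)
   + (\sum_(1 <= i < n) hcoef i q * hcoef i p
     - \sum_(1 <= i < n.-1) hcoef i.+1 q * hcoef i p)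
   = (p == q)%:R - n%:R^-1.
  have := @cartan_sum (hcoef^~ p) (hcoef^~ q) n.-2.
  have -> : n.-2.+2 = n by lia.
  have -> : n.-2.+1 = n.-1 by lia.
  move=> -> //; [|exact: h0|exact: h0|exact: hn|exact: hn].
  rewrite (eq_big_nat _ _ (F2 := fun i => (i == p)%:R * (i == q)%:R
     - n%:R^-1 * (i == p)%:R - n%:R^-1 * (i == q)%:R + n%:R^-1 * n%:R^-1));
    last first.
    by case=> // i _ /=; rewrite !hcoef_step //; ring.
  rewrite big_split !sumrB /= -!mulr_sumr.
  rewrite (sum_indicator (fun i => (i == p)%:R) hq).
  have S1 r : (1 <= r <= n)%N -> \sum_(1 <= i < n.+1) (i == r)%:R = 1 :> F.
    move=> hr; rewrite -[RHS](sum_indicator (fun=> 1) hr).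
    by apply: eq_bigr => i _; rewrite mul1r.
  rewrite !S1 // sumr_const_nat subn1 /= -mulr_natl eq_sym.
  by field.
rewrite -cs /r0coef; case: ifP => _; ring.
Qed.

(** By duality a root contracted into one slot selects single coweights. The two sums give h_beta -
    h_{beta-1} + h_alpha - h_{alpha+1}; this is 0 if beta = alpha + 1 and is otherwise cancelled by
    the epsilon terms. *)
Lemma r0coef_bd alpha beta q :
  (1 <= alpha)%N -> (alpha < beta)%N -> (beta < n)%N ->
  r0coef alpha beta beta q - r0coef alpha beta beta.+1 q
  + r0coef alpha beta q alpha - r0coef alpha beta q alpha.+1 = 0.
Proof.
move=> a1 ab bn; have n0 : (0 < n)%N by lia.
have sum1 (G : nat -> F) m c : (1 <= c < m)%N ->
    \sum_(1 <= i < m) (i == c)%:R * G i = G c.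
  case: m => [|m] hc; first lia.
  rewrite -[RHS](sum_indicator (n := m) G); last lia.
  by apply: eq_bigr => i _; rewrite mulrC.
have e1 : \sum_(1 <= i < n) hcoef i beta * hcoef i q
    - \sum_(1 <= i < n) hcoef i beta.+1 * hcoef i q = hcoef beta q.
  rewrite -sumrB -[RHS](sum1 (hcoef^~ q) n); last lia.
  by apply: eq_bigr => i _; rewrite -mulrBl hcoef_root.
have e2 : \sum_(1 <= i < n.-1) hcoef i.+1 beta * hcoef i q
    - \sum_(1 <= i < n.-1) hcoef i.+1 beta.+1 * hcoef i q = hcoef beta.-1 q.
  rewrite -sumrB -[RHS](sum1 (hcoef^~ q) n.-1); last lia.
  apply: eq_bigr => i _; rewrite -mulrBl hcoef_root //.
  by congr (_%:R * _); lia.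
have e3 : \sum_(1 <= i < n) hcoef i q * hcoef i alpha
    - \sum_(1 <= i < n) hcoef i q * hcoef i alpha.+1 = hcoef alpha q.
  rewrite -sumrB -[RHS](sum1 (hcoef^~ q) n); last lia.
  by apply: eq_bigr => i _; rewrite -mulrBr hcoef_root // mulrC.
have e4 : \sum_(1 <= i < n.-1) hcoef i.+1 q * hcoef i alpha
    - \sum_(1 <= i < n.-1) hcoef i.+1 q * hcoef i alpha.+1 = hcoef alpha.+1 q.
  rewrite -sumrB -[RHS](sum1 (fun i => hcoef i.+1 q) n.-1); last lia.
  by apply: eq_bigr => i _; rewrite -mulrBr hcoef_root // mulrC.
have rt i p : hcoef i p = (i == p)%:R + hcoef i p.+1.
  by rewrite -hcoef_root //; ring.
move/eqP: e1; rewrite subr_eq => /eqP e1.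
move/eqP: e2; rewrite subr_eq => /eqP e2.
move/eqP: e3; rewrite subr_eq => /eqP e3.
move/eqP: e4; rewrite subr_eq => /eqP e4.
rewrite /r0coef e1 e2 e3 e4; case: eqP => [-> /=|b]; first ring.
rewrite !(rt _ beta) !(rt _ alpha) !eqxx.
have [-> -> -> ->] : [/\ (alpha == beta) = false, (beta == alpha) = false,
  (beta.-1 == beta) = false & (beta.-1 == alpha) = false] by split; lia.
have [-> ->] : (alpha.+1 == beta) = false /\ (alpha.+1 == alpha) = false by lia.
rewrite /=; ring.
Qed.

End TorusForm.

(** * Entries and traces *)

Section Entries.
Variables (R : comNzRingType) (n : nat).

Lemma sum_nat_ord (G : nat -> R) :
  \sum_(1 <= i < n.+1) G i = \sum_(i < n) G i.+1.
Proof. by rewrite big_add1 big_mkord. Qed.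

(* The entry in row a and column b counted from 1, and 0 outside [1, n]. *)
Definition ent (A : 'M[R]_n) (a b : nat) : R :=
  \sum_(i < n | i.+1 == a) \sum_(j < n | j.+1 == b) A i j.

Lemma entE A (i j : 'I_n) : ent A i.+1 j.+1 = A i j.
Proof.
rewrite /ent (big_pred1 i); last by move=> k; rewrite /= eqSS.
by rewrite (big_pred1 j) // => k; rewrite /= eqSS.
Qed.

Lemma ent_tr A B :
  \sum_(1 <= b < n.+1) \sum_(1 <= a < n.+1) ent A a b * ent B b a
  = \tr (A *m B).
Proof.
rewrite exchange_big sum_nat_ord /mxtrace; apply: eq_bigr => i _.
rewrite mxE sum_nat_ord; apply: eq_bigr => j _.
by rewrite !entE.
Qed.

Lemma entD A B a b : ent (A + B) a b = ent A a b + ent B a b.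
Proof.
rewrite /ent -big_split; apply: eq_bigr => i _.
by rewrite -big_split; apply: eq_bigr => j _; rewrite mxE.
Qed.

Lemma entZ c A a b : ent (c *: A) a b = c * ent A a b.
Proof.
rewrite /ent mulr_sumr; apply: eq_bigr => i _.
by rewrite mulr_sumr; apply: eq_bigr => j _; rewrite mxE.
Qed.

Lemma ent_combl f g (A B M : 'M[R]_n) a b :
  ent ((g *: A + f *: B) *m M) a b
  = ent (A *m M) a b * g + f * ent (B *m M) a b.
Proof. by rewrite mulmxDl -!scalemxAl entD !entZ [g * _]mulrC. Qed.

Lemma ent_combr f g (A B M : 'M[R]_n) a b :
  ent (M *m (g *: A + f *: B)) a b
  = ent (M *m A) a b * g + f * ent (M *m B) a b.
Proof. by rewrite mulmxDr -!scalemxAr entD !entZ [g * _]mulrC. Qed.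

Lemma ent_euler (A M : 'M[R]_n) : \sum_(1 <= a < n.+1) ent (A *m M) a a
  = \sum_(1 <= a < n.+1) ent (M *m A) a a.
Proof.
have E B : \sum_(1 <= a < n.+1) ent B a a = \tr B.
  by rewrite sum_nat_ord; apply: eq_bigr => i _; rewrite entE.
by rewrite !E mxtrace_mulC.
Qed.

(** The two sides are tr(A M B M) and tr(M A M B), equal by cyclicity. *)
Lemma ent_casimir (A B M : 'M[R]_n) :
  \sum_(1 <= b < n.+1) \sum_(1 <= a < n.+1)
    ent (A *m M) a b * ent (B *m M) b a
  = \sum_(1 <= b < n.+1) \sum_(1 <= a < n.+1)
    ent (M *m A) a b * ent (M *m B) b a.
Proof. by rewrite !ent_tr !mulmxA mxtrace_mulC !mulmxA. Qed.

Lemma tr_tens (A B : 'M[R]_n) : \tr (A *t B) = \tr A * \tr B.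
Proof.
rewrite /mxtrace mulr_sum; apply: eq_bigr => k _.
by rewrite mxE.
Qed.

Lemma tr_tens_mul (A B C D : 'M[R]_n) :
  \tr ((A *t B) *m (C *t D)) = \tr (A *m C) * \tr (B *m D).
Proof. by rewrite tensmx_mul tr_tens. Qed.

Lemma tr_unit_mul a b (A : 'M[R]_n) :
  \tr ((\matrix_(i, j) ((i.+1 == a) && (j.+1 == b))%:R) *m A) = ent A b a.
Proof.
rewrite /mxtrace /ent exchange_big /= [RHS]big_mkcond /=.
apply: eq_bigr => i _; rewrite mxE; case: eqP => ia; last first.
  by rewrite big1 // => j _; rewrite mxE; case: eqP ia => //= _ _; rewrite mul0r.
rewrite [RHS]big_mkcond /=; apply: eq_bigr => j _; rewrite mxE ia eqxx /=.
by case: eqP => _; rewrite ?mul1r ?mul0r.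
Qed.

Lemma tr_diag_mul (d : nat -> R) (A : 'M[R]_n) :
  \tr (diag_mx (\row_(a < n) d a.+1) *m A)
  = \sum_(1 <= p < n.+1) d p * ent A p p.
Proof.
rewrite sum_nat_ord /mxtrace; apply: eq_bigr => i _.
by rewrite mul_diag_mx !mxE entE.
Qed.

End Entries.

(** * Polynomials as a biaction *)

Section Instance.
Variables (F : fieldType) (n : nat).
Local Notation MP := {mpoly F[n * n]}.
Local Notation x := (@x F n).
Local Notation X := (@X F n).

Lemma xE (i j : 'I_n) : x i.+1 j.+1 = 'X_(mxvec_index i j).
Proof.
rewrite /Defs.x (big_pred1 i); last by move=> k; rewrite /= eqSS.
by rewrite (big_pred1 j) ?mxE // => k; rewrite /= eqSS.
Qed.

Lemma x_notin a b : ~~ ((1 <= a <= n)%N && (1 <= b <= n)%N) -> x a b = 0.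
Proof.
move=> h; rewrite /Defs.x big1 // => i /eqP ia; rewrite big1 // => j /eqP jb.
have := ltn_ord i; have := ltn_ord j; lia.
Qed.

Lemma mderiv_x (k l : 'I_n) a b :
  mderiv (mxvec_index k l) (x a b) = ((a == k.+1) && (b == l.+1))%:R.
Proof.
case: (boolP ((1 <= a <= n)%N && (1 <= b <= n)%N)) => [|h]; last first.
  rewrite x_notin // mderiv0.
  have -> // : (a == k.+1) && (b == l.+1) = false.
  by apply: contraNF h => /andP[/eqP-> /eqP->]; rewrite !ltn_ord.
case/andP=> ha hb.
have [ha' hb'] : (a.-1 < n)%N /\ (b.-1 < n)%N by lia.
have -> : a = (Ordinal ha').+1 by rewrite /=; lia.
have -> : b = (Ordinal hb').+1 by rewrite /=; lia.
rewrite xE mderivX mnm1E !eqSS.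
have <- : (mxvec_index (Ordinal ha') (Ordinal hb') == mxvec_index k l)
    = (Ordinal ha' == k) && (Ordinal hb' == l).
  apply/eqP/andP=> [|[/eqP-> /eqP->] //].
  (* Injectivity of [mxvec_index] is read off from unit row vectors, which [vec_mx] turns into
     matrix units. *)
  move/(congr1 (fun i => vec_mx (delta_mx (0 : 'I_1) i) k l : rat)).
  rewrite !vec_mx_delta !mxE !eqxx /=.
  by rewrite eq_sym [l == _]eq_sym; case: (_ == k); case: (_ == l).
case: eqP => [->|_]; rewrite ?scale0r // scale1r.
rewrite (_ : (_ - _)%MM = 0%MM) ?mpolyX0 //.
by apply/mnmP=> i; rewrite mnmBE subnn mnm0E.
Qed.

Lemma nablaD (f g : MP) : nabla (f + g) = nabla f + nabla g.
Proof. by apply/matrixP => i j; rewrite !mxE mderivD. Qed.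

Lemma nablaM (f g : MP) : nabla (f * g) = g *: nabla f + f *: nabla g.
Proof. by apply/matrixP => i j; rewrite !mxE mderivM mulrC. Qed.

(** Since [nabla] is transposed, this is the sum over k of x_kb d/dx_ka, and [mp_rowD a b] is the
    sum over k of x_ak d/dx_bk; hence the different roles of the indices. *)
Definition mp_colD a b (f : MP) : MP := ent (nabla f *m X) a b.
Definition mp_rowD a b (f : MP) : MP := ent (X *m nabla f) a b.

Lemma mp_colD_der a b : derivation (mp_colD a b).
Proof.
split=> f g; rewrite /mp_colD; first by rewrite nablaD mulmxDl entD.
by rewrite nablaM; apply: ent_combl.
Qed.

Lemma mp_rowD_der a b : derivation (mp_rowD a b).
Proof.
split=> f g; rewrite /mp_rowD; first by rewrite nablaD mulmxDr entD.
by rewrite nablaM; apply: ent_combr.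
Qed.

Lemma mp_colD_crd a b i j : (1 <= a <= n)%N ->
  mp_colD a b (x i j) = if j == a then x i b else 0.
Proof.
move=> ha; have ha' : (a.-1 < n)%N by lia.
have -> : a = (Ordinal ha').+1 by rewrite /=; lia.
rewrite /mp_colD /ent (big_pred1 (Ordinal ha')); last first.
  by move=> k; rewrite /= eqSS.
transitivity (\sum_(l < n | l.+1 == b) \sum_(k < n)
    ((i == k.+1) && (j == (Ordinal ha').+1))%:R * X k l : MP).
  apply: eq_bigr => l _; rewrite mxE; apply: eq_bigr => k _.
  by rewrite !mxE mderiv_x.
case: (j == _); last first.
  by rewrite big1 // => l _; rewrite big1 // => k _; rewrite andbF mul0r.
rewrite exchange_big /Defs.x [RHS]big_mkcond; apply: eq_bigr => k _ /=.
rewrite andbT [i == _]eq_sym; case: (_ == i); last first.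
  by rewrite big1 // => l _; rewrite mul0r.
by apply: eq_bigr => l _; rewrite mul1r.
Qed.

Lemma mp_rowD_crd a b i j : (1 <= b <= n)%N ->
  mp_rowD a b (x i j) = if i == b then x a j else 0.
Proof.
move=> hb; have hb' : (b.-1 < n)%N by lia.
have -> : b = (Ordinal hb').+1 by rewrite /=; lia.
rewrite /mp_rowD /ent.
transitivity (\sum_(k < n | k.+1 == a) \sum_(l < n)
    X k l * ((i == (Ordinal hb').+1) && (j == l.+1))%:R : MP).
  apply: eq_bigr => k _; rewrite (big_pred1 (Ordinal hb')); last first.
    by move=> l; rewrite /= eqSS.
  by rewrite mxE; apply: eq_bigr => l _; rewrite [nabla _ _ _]mxE mderiv_x.
case: (i == _); last first.
  by rewrite big1 // => k _; rewrite big1 // => l _; rewrite mulr0.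
apply: eq_bigr => k _; rewrite [RHS]big_mkcond; apply: eq_bigr => l _ /=.
by rewrite [j == _]eq_sym; case: (_ == j); rewrite ?mulr1 ?mulr0.
Qed.

Lemma mp_euler (f : MP) : \sum_(1 <= a < n.+1) mp_colD a a f
  = \sum_(1 <= a < n.+1) mp_rowD a a f.
Proof.
exact: ent_euler.
Qed.

Lemma mp_casimir (f g : MP) :
  \sum_(1 <= b < n.+1) \sum_(1 <= a < n.+1) mp_colD a b f * mp_colD b a g
  = \sum_(1 <= b < n.+1) \sum_(1 <= a < n.+1) mp_rowD a b f * mp_rowD b a g.
Proof. exact: ent_casimir. Qed.

Definition mp_biaction : biaction MP n :=
  Biaction mp_colD_der mp_rowD_der mp_colD_crd mp_rowD_crd mp_euler mp_casimir.

Local Notation cst := (map_mx (@mpolyC (n * n) F)).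

Section BracketForm.
Variables (alpha beta : nat) (eta zeta : 'M[MP]_n).

Let Phi (M : 'M[F]_(n * n)) : MP := \tr (cst M *m (eta *t zeta)).

Let PhiD M N : Phi (M + N) = Phi M + Phi N.
Proof. by rewrite /Phi map_mxD mulmxDl mxtraceD. Qed.

Let PhiN M : Phi (- M) = - Phi M.
Proof. by rewrite /Phi map_mxN mulNmx raddfN. Qed.

Let Phi0 : Phi 0 = 0.
Proof. by rewrite /Phi map_mx0 mul0mx mxtrace0. Qed.

Let Phi_sum (r : seq nat) (G : nat -> 'M[F]_(n * n)) :
  Phi (\sum_(i <- r) G i) = \sum_(i <- r) Phi (G i).
Proof.
elim: r => [|i r IH]; first by rewrite !big_nil Phi0.
by rewrite !big_cons PhiD IH.
Qed.

Let Phi_tensor A B : Phi (tensor A B) = \tr (cst A *m eta) * \tr (cst B *m zeta).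
Proof. by rewrite /Phi /tensor map_mxT tr_tens_mul. Qed.

Let tr_e a b (A : 'M[MP]_n) : \tr (cst (e F n a b) *m A) = ent A b a.
Proof.
rewrite -tr_unit_mul; congr (\tr (_ *m _)); apply/matrixP => i j.
by rewrite !mxE mpolyC_nat.
Qed.

Let htr i (A : 'M[MP]_n) : MP :=
  \sum_(1 <= p < n.+1) (hcoef F n i p)%:MP * ent A p p.

Let tr_h i (A : 'M[MP]_n) : \tr (cst (h F n i) *m A) = htr i A.
Proof.
rewrite /htr -tr_diag_mul; congr (\tr (_ *m _)); apply/matrixP => a b.
by rewrite !mxE /hcoef; case: (a == b); rewrite ?mulr1n ?mulr0n ?mulr0 ?mpolyC0.
Qed.

Let L (rho : nat -> nat -> F) : MP :=
  \sum_(1 <= p < n.+1) \sum_(1 <= q < n.+1)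
    (rho p q)%:MP * (ent eta p p * ent zeta q q).

Let LD r1 r2 : L (fun p q => r1 p q + r2 p q) = L r1 + L r2.
Proof.
rewrite /L -big_split; apply: eq_bigr => p _; rewrite -big_split.
by apply: eq_bigr => q _; rewrite mpolyCD mulrDl.
Qed.

Let LN r : L (fun p q => - r p q) = - L r.
Proof.
rewrite /L -sumrN; apply: eq_bigr => p _; rewrite -sumrN.
by apply: eq_bigr => q _; rewrite mpolyCN mulNr.
Qed.

Let L0 : L (fun _ _ => 0) = 0.
Proof.
by rewrite /L big1 // => p _; rewrite big1 // => q _; rewrite mpolyC0 mul0r.
Qed.

Let L_sum (r : seq nat) (G : nat -> nat -> nat -> F) :
  L (fun p q => \sum_(i <- r) G i p q) = \sum_(i <- r) L (G i).
Proof.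
elim: r => [|i r IH].
  rewrite big_nil -[RHS]L0; apply: eq_bigr => p _; apply: eq_bigr => q _.
  by rewrite big_nil.
rewrite big_cons -IH -LD; apply: eq_bigr => p _; apply: eq_bigr => q _.
by rewrite big_cons.
Qed.

Let L_prod i j :
  L (fun p q => hcoef F n i p * hcoef F n j q) = htr i eta * htr j zeta.
Proof.
rewrite /L /htr mulr_suml; apply: eq_bigr => p _; rewrite mulr_sumr.
by apply: eq_bigr => q _; rewrite mpolyCM mulrACA.
Qed.

Let Phi_h i j : Phi (tensor (h F n i) (h F n j))
  = L (fun p q => hcoef F n i p * hcoef F n j q).
Proof. by rewrite Phi_tensor !tr_h L_prod. Qed.

Let Phi_r0 : Phi (r0 F n alpha beta) = L (r0coef F n alpha beta).
Proof.
rewrite /r0 /r0coef !LD LN !L_sum !PhiD PhiN !Phi_sum.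
congr (_ - _ + _); try by apply: eq_bigr => i _; rewrite Phi_h.
case: ifP => _; first by rewrite Phi0 L0.
by rewrite !LD !LN /wedge !PhiD !PhiN !Phi_h.
Qed.

Lemma sum_above_diag (G : nat -> nat -> MP) m :
  \sum_(1 <= i < m.+1) \sum_(i.+1 <= j < m.+1) G i j
  = \sum_(1 <= j < m.+1) \sum_(1 <= i < j) G i j.
Proof.
elim: m => [|m IH]; first by rewrite !big_geq.
rewrite [RHS]big_nat_recr //= -IH [LHS]big_nat_recr //=.
rewrite [X in _ + X]big_geq // addr0 -big_split.
by apply: eq_big_nat => i /andP[_ hi]; rewrite big_nat_recr.
Qed.

(** Pairing with e_ab reads the entry in row b and column a, so the indices are transposed with
    respect to [rmx]. *)
Definition rform : MP := L (r0coef F n alpha beta)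
  + upper n (fun a b => ent eta a b * ent zeta b a)
  + (ent eta alpha alpha.+1 * ent zeta beta.+1 beta
     - ent eta beta.+1 beta * ent zeta alpha alpha.+1).

Lemma trace_form :
  \tr (cst (rmx F n alpha beta) *m (eta *t zeta)) = rform.
Proof.
rewrite -/(Phi _) /rmx 2!PhiD Phi_r0; congr (_ + _ + _).
  rewrite /upper -sum_above_diag Phi_sum; apply: eq_bigr => i _.
  by rewrite Phi_sum; apply: eq_bigr => j _; rewrite Phi_tensor !tr_e.
by rewrite /wedge PhiD PhiN !Phi_tensor !tr_e.
Qed.

End BracketForm.

Definition mp_rho alpha beta p q : MP := (r0coef F n alpha beta p q)%:MP.

Lemma tr_Rplus alpha beta (eta zeta : 'M[MP]_n) :
  \tr (Rplus alpha beta eta *m zeta) = rform alpha beta eta zeta.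
Proof. by etransitivity; [apply: RplusE | apply: trace_form]. Qed.

Let regroup (R : comNzRingType) (a b c d u v : R) :
  (a + b + c) - (d + u + v) = (a - d) + (b - u) + c - v.
Proof. ring. Qed.

Lemma bracketE alpha beta (f g : MP) : bracket alpha beta f g
  = br mp_biaction alpha beta (mp_rho alpha beta) f g.
Proof.
transitivity (rform alpha beta (nabla f *m X) (nabla g *m X)
  - rform alpha beta (X *m nabla f) (X *m nabla g)).
  by congr (_ - _); apply: tr_Rplus.
rewrite /rform regroup /br; congr (_ + _ + _ - _).
rewrite /tor -sumrB; apply: eq_bigr => p _; rewrite -sumrB.
by apply: eq_bigr => q _; rewrite -mulrBr.
Qed.

End Instance.

Lemma subst_notin a b J : a \notin J -> subst_idx a b J = J.
Proof.
move=> aJ; rewrite /subst_idx map_id_in // => c cJ.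
by case: eqP => // E; rewrite -E cJ in aJ.
Qed.

Lemma subst_last_itv a b c : (1 <= a <= b)%N ->
  rcons (itv a b.-1) c = subst_idx b c (itv a b).
Proof.
case: b => [|b] ab; first lia.
have -> : itv a b.+1 = rcons (itv a b) b.+1.
  rewrite /itv /index_iota (_ : b.+2 - a = b.+1 - a + 1)%N; last lia.
  by rewrite iotaD /= cats1; congr rcons; lia.
rewrite /subst_idx map_rcons eqxx -/(subst_idx b.+1 c _) subst_notin //.
by rewrite mem_itv; lia.
Qed.

Lemma subst_head_itv a b c : (a <= b)%N ->
  c :: itv a.+1 b = subst_idx a c (itv a b).
Proof.
move=> ab; have -> : itv a b = a :: itv a.+1 b.
  by rewrite /itv /index_iota subSS subSn.
rewrite /subst_idx /= eqxx -/(subst_idx a c _) subst_notin //.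
by rewrite mem_itv; lia.
Qed.

(** * The family of the theorem *)

Section Family.
Variables (F : fieldType) (n alpha beta : nat).
Hypotheses (alpha_ge1 : (1 <= alpha)%N) (alpha_beta : (alpha < beta)%N)
  (beta_le : (beta <= n.-1)%N).

Local Notation S := (mp_biaction F n).
Local Notation T := (transpose S).

Let fA k : (1 <= k <= alpha)%N -> f F n (n + k - alpha) k = minA alpha S k.
Proof.
move=> hk; rewrite /f /lastrow /lastcol; case: leqP => h; first lia.
by have -> : (n - (n + k - alpha) + k = alpha)%N by lia.
Qed.

Let fAr k : (1 <= k <= alpha)%N ->
  f_right F n (n + k - alpha) k = minDA alpha S k.
Proof.
move=> hk; rewrite /f_right /lastrow /lastcol; case: leqP => h; first lia.
have -> : (n - (n + k - alpha) + k = alpha)%N by lia.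
by rewrite subst_last_itv.
Qed.

Let fB : f F n 1 beta.+1 = minB beta S.
Proof. by rewrite /f /lastrow /lastcol /= addn1 subSS. Qed.

Let fBl : f_left F n 1 beta.+1 = minEB beta S.
Proof.
by rewrite /f_left /lastrow /lastcol /= addn1 subSS (@subst_head_itv _ n); last lia.
Qed.

Let fP m : (1 <= m <= beta)%N -> f F n m (n + m - beta) = minA beta T m.
Proof.
move=> hm; rewrite /f /lastrow /lastcol; case: leqP => h; last lia.
have -> : (n + m - (n + m - beta) = beta)%N by lia.
by rewrite /minA mn_transpose // !size_itv; lia.
Qed.

Let fPd m : (1 <= m <= beta)%N -> f_down F n m (n + m - beta) = minDA beta T m.
Proof.
move=> hm; rewrite /f_down /lastrow /lastcol; case: leqP => h; last lia.
have -> : (n + m - (n + m - beta) = beta)%N by lia.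
by rewrite /minDA mn_transpose ?subst_last_itv // size_subst !size_itv; lia.
Qed.

Let fQ : f F n alpha.+1 1 = minQ alpha S.
Proof.
rewrite /f /lastrow /lastcol; case: leqP => h; last lia.
by have -> : (n - alpha.+1 + 1 = n - alpha)%N by lia.
Qed.

Let fQu : f_up F n alpha.+1 1 = minUQ alpha S.
Proof.
rewrite /f_up /lastrow /lastcol; case: leqP => h; last lia.
have -> : (n - alpha.+1 + 1 = n - alpha)%N by lia.
by rewrite subst_head_itv //; lia.
Qed.

Let BT : minB alpha T = minQ alpha S.
Proof. by apply: mn_transpose; rewrite !size_itv; lia. Qed.

Let EBT : minEB alpha T = minUQ alpha S.
Proof. by apply: mn_transpose; rewrite size_subst !size_itv; lia. Qed.

Let QT : minQ beta T = minB beta S.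
Proof. by apply: mn_transpose; rewrite !size_itv; lia. Qed.

Let UQT : minUQ beta T = minEB beta S.
Proof. by apply: mn_transpose; rewrite size_subst !size_itv; lia. Qed.

Lemma thetaE k : (1 <= k <= alpha)%N ->
  theta F n alpha beta k = thetaB alpha beta S k.
Proof.
move=> hk; rewrite /theta /thetaB /Bhat /EBhat; case: eqP => [h|_]; last first.
  by rewrite /theta_gen fA // fAr // fB fBl.
(* For 2 beta = n the first factor of psi_1 is f_{1,beta+1} itself. *)
have eb : (n + 1 - beta = beta.+1)%N by lia.
have nb : (n - beta = beta)%N by lia.
rewrite fA // fAr //; congr (_ * _ - _ * _).
  rewrite /psi_gen eb fB fQ fQu; congr (_ - _ * _).
  rewrite /f_down /lastrow /lastcol /= addn1 subSS /minSB nb.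
  by rewrite subst_last_itv; last lia.
rewrite /psi1_star fQ fQu /minESB /minEB nb.
by rewrite !subst_head_itv ?subst_last_itv //; lia.
Qed.

Lemma psiE m : (1 <= m <= beta)%N ->
  psi F n alpha beta m = thetaB beta alpha T m.
Proof.
move=> hm; rewrite /psi /thetaB /Bhat /EBhat; case: eqP => [h|_]; last first.
  by rewrite /psi_gen fP // fPd // fQ fQu BT EBT.
have ea : (n + 1 - alpha = alpha.+1)%N by lia.
have na : (n - alpha = alpha)%N by lia.
rewrite fP // fPd // BT EBT QT UQT; congr (_ * _ - _ * _).
  rewrite /theta_gen ea fB fQ fBl; congr (_ - _ * _).
  rewrite /minSB mn_transpose ?size_subst ?size_itv; last lia.
  rewrite /f_right /lastrow /lastcol; case: leqP => h1; last lia.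
  have -> : (n - alpha.+1 + 1 = n - alpha)%N by lia.
  by rewrite na subst_last_itv //; lia.
rewrite /theta1_star fB fBl /minESB mn_transpose ?size_subst ?size_itv; last lia.
rewrite /minUQ na; rewrite !subst_head_itv ?subst_last_itv //; try lia.
Qed.

Lemma calB_log_family p : calB alpha beta p -> log_family alpha beta S p.
Proof.
move=> [i [j [hi hj ->]]]; rewrite /phi.
case: ifP => [/andP[hj' /eqP _]|h1].
  by apply: Or32; exists j; rewrite thetaE.
case: ifP => [/andP[hi' /eqP _]|h2].
  by apply: Or33; exists i; rewrite psiE.
apply: Or31; exists i, j; split=> //.
by rewrite /ordinary hi hj h1 h2.
Qed.

End Family.

Theorem theorem3p2 (F : fieldType) (n alpha beta : nat)
    (charF : [pchar F] =i pred0)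
    (n_ge3 : (3 <= n)%N)
    (alpha_ge1 : (1 <= alpha)%N) (alpha_beta : (alpha < beta)%N)
    (beta_le : (beta <= n.-1)%N) :
  log_canonical (@bracket F n alpha beta) (@calB F n alpha beta).
Proof.
move=> p q Bp Bq.
(* Exponents are constant polynomials, so that they lie in the same ring as the functions. *)
pose K (u : {mpoly F[n * n]}) := exists2 c : F, is_rational c & u = c%:MP.
have bd : bd_form n alpha beta K (@mp_rho F n alpha beta) (n%:R^-1)%:MP.
  split; try lia.
  - by exists 1; rewrite ?mpolyC1 //; apply: (is_rational_nat F 1).
  - move=> _ _ [c qc ->] [d qd ->]; exists (c - d); last by rewrite mpolyCB.
    exact: is_rationalB.
  - move=> i j; exists (r0coef F n alpha beta i j) => //.
    by apply: is_rational_r0coef => //; lia.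
  - move=> i j hi hj; rewrite /mp_rho -mpolyCD r0coef_sym //; last lia.
    by rewrite mpolyCB mpolyC_nat.
  - move=> j _; rewrite /mp_rho -mpolyCB -mpolyCD -mpolyCB r0coef_bd //; lia.
have FB := calB_log_family alpha_ge1 alpha_beta beta_le.
have [u [[c qc ->] e]] := lc_family bd (FB _ _ Bp) (FB _ _ Bq).
have [w cw] := is_rational_ratr charF qc.
by exists w; rewrite bracketE e cw mul_mpolyC.
Qed.
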